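(* Let $F$ be a locally compact non-Archimedean valued field of characteristic zero, $\Sigma$ a compact Riemann surface of genus at least $2$, $\Gamma=\pi_1(\Sigma)$, and $\rho:\Gamma\to\mathrm{SL}_2(F)$ a reductive representation. If $\rho$ is unbounded, then the induced action of $\Gamma$ on the Bruhat–Tits tree $T_F$ of $\mathrm{SL}_2(F)$ is not small. In particular, there exists an edge $e$ of $T_F$ such that for every $\gamma\in\Gamma$, the stabilizer in $\Gamma$ of the edge $\gamma.e$ contains a free group of rank two. Moreover, if $\rho$ is topologically dense in $\mathrm{SL}_2(F)$, then the stabilizer in $\Gamma$ of every edge of $T_F$ contains a free subgroup of rank two.
   Context: A non-Archimedean valued field $F$ carries a discrete valuation $v:F^\times\to\mathbb{Z}$ and absolute value $|x|=c^{v(x)}$, $c\in(0,1)$; it is locally compact if it is complete with finite residue field. $\mathcal{O}_v=\{v\ge0\}$, $\pi$ is a uniformizer. The Bruhat–Tits tree $T_F$ has as vertices the homothety classes of $\mathcal{O}_v$-lattices in $F^2$, with $[\Lambda],[\Lambda']$ joined by an edge (of length $1$) iff representatives satisfy $\pi\Lambda\subsetneq\Lambda'\subsetneq\Lambda$; $\mathrm{SL}_2(F)$ acts on it isometrically, and $\Gamma$ acts through $\rho$. The stabilizer of an edge $e$ in $\Gamma$ is $\{\gamma\in\Gamma:\rho(\gamma)\in\mathrm{Stab}_{\mathrm{SL}_2(F)}(e)\}$. A $\Gamma$-action on a tree is small if no edge stabilizer contains a free subgroup of rank two. $\rho$ is reductive if it is irreducible (no invariant line in $F^2$) or completely reducible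 (two distinct invariant lines in $F^2$). $\rho$ is bounded if $\rho(\Gamma)$ is a bounded subset of $\mathrm{SL}_2(F)$ for $|\cdot|$, and unbounded otherwise. $\rho$ is topologically dense if $\rho(\Gamma)$ is dense in $\mathrm{SL}_2(F)$ for the topology induced by $|\cdot|$. *)

(* Defs.v *)
From HB Require Import structures.
From mathcomp Require Import all_boot all_order all_algebra.
From mathcomp Require Import complex.
From mathcomp Require Import all_classical all_reals all_analysis.

Set Implicit Arguments.
Unset Strict Implicit.
Unset Printing Implicit Defensive.

Import Order.TTheory GRing.Theory Num.Theory.
Import numFieldNormedType.Exports.

Local Open Scope classical_set_scope.
Local Open Scope ring_scope.

Section Valuation.
Variables (F : fieldType) (v : F -> int).

(* A valuation F^* -> Z is encoded as a total function on F; its value at 0 is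
   never used, and 0 is treated as having infinite valuation. *)
Definition discrete_valuation : Prop :=
  (forall x y, x != 0 -> y != 0 -> v (x * y) = v x + v y) /\
  (forall x y, x != 0 -> y != 0 -> x + y != 0 ->
     Num.min (v x) (v y) <= v (x + y)).

Definition valuation_ring : set F := [set x | x = 0 \/ 0 <= v x].

Definition maximal_ideal : set F := [set x | x = 0 \/ 0 < v x].

(* A generator of the maximal ideal; v is not assumed to be onto Z, so
   v pi may differ from 1. *)
Definition uniformizer (pi : F) : Prop :=
  [/\ pi != 0, 0 < v pi & forall x, x != 0 -> 0 < v x -> v pi <= v x].

(* The underlying set of the residue field, as the set of cosets. *)
Definition residue_field : set (set F) :=
  [set [set x + y | y in maximal_ideal] | x in valuation_ring].

Variables (R : realType) (c : R).

Definition vabs (x : F) : R := if x == 0 then 0 else c ^ v x.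

Definition vcauchy (u : nat -> F) : Prop :=
  forall e : R, 0 < e ->
    exists N, forall m n, (N <= m)%N -> (N <= n)%N -> vabs (u m - u n) < e.

Definition vcvg (u : nat -> F) (l : F) : Prop :=
  forall e : R, 0 < e -> exists N, forall n, (N <= n)%N -> vabs (u n - l) < e.

Definition vcomplete : Prop := forall u, vcauchy u -> exists l, vcvg u l.

Definition locally_compact_valued_field : Prop :=
  vcomplete /\ finite_set residue_field.

End Valuation.

Section Representation.
Variables (F : fieldType) (v : F -> int) (R : realType) (c : R).
Variables (G : groupType) (rho : G -> 'M[F]_2).

Definition SL2_representation : Prop :=
  (forall x, \det (rho x) = 1) /\
  (forall x y, rho (x * y)%g = rho x *m rho y).

Definition is_line (L : set 'cV[F]_2) : Prop :=
  exists2 u : 'cV[F]_2, u != 0 & L = [set a *: u | a in [set: F]].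

Definition invariant_line (L : set 'cV[F]_2) : Prop :=
  is_line L /\ forall x, [set rho x *m u | u in L] `<=` L.

Definition irreducible_rep : Prop := ~ exists L, invariant_line L.

Definition completely_reducible_rep : Prop :=
  exists L L', [/\ invariant_line L, invariant_line L' & L <> L'].

Definition reductive_rep : Prop :=
  irreducible_rep \/ completely_reducible_rep.

Definition bounded_rep : Prop :=
  exists M : R, forall x i j, vabs v c (rho x i j) <= M.

Definition dense_rep : Prop :=
  forall (A : 'M[F]_2) (e : R), \det A = 1 -> 0 < e ->
    exists x, forall i j, vabs v c (rho x i j - A i j) < e.

End Representation.

Section FreeSubgroup.
Variable G : groupType.

(* A letter (i, b) stands for x_i if b = false and for its inverse if
   b = true. *)
Definition letter_val (x : 'I_2 -> G) (l : 'I_2 * bool) : G :=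
  if l.2 then ((x l.1)^-1)%g else x l.1.

Definition word_val (x : 'I_2 -> G) (w : seq ('I_2 * bool)) : G :=
  foldr (fun l y => (letter_val x l * y)%g) 1%g w.

Definition reduced_word (w : seq ('I_2 * bool)) : bool :=
  sorted (fun l l' => ~~ ((l.1 == l'.1) && (l.2 != l'.2))) w.

Definition freely_independent (x : 'I_2 -> G) : Prop :=
  forall w, reduced_word w -> w <> [::] -> word_val x w <> 1%g.

(* The range of word_val x is the subgroup generated by x. *)
Definition contains_free_rank2 (H : set G) : Prop :=
  exists x : 'I_2 -> G, freely_independent x /\ range (word_val x) `<=` H.

End FreeSubgroup.

Section SmallAction.
Variables (G : groupType) (V : Type) (act : G -> V -> V).

(* An edge of a graph on V is a set of two vertices. *)
Definition edge_action (x : G) (e : set V) : set V := [set act x p | p in e].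

Definition edge_stabilizer (e : set V) : set G :=
  [set x | edge_action x e = e].

Definition small_action (E : set (set V)) : Prop :=
  forall e, E e -> ~ contains_free_rank2 (edge_stabilizer e).

End SmallAction.

Section BruhatTitsTree.
Variables (F : fieldType) (v : F -> int) (pi : F).

Definition scale_set (a : F) (L : set 'cV[F]_2) : set 'cV[F]_2 :=
  [set a *: x | x in L].

(* The lattice spanned over the valuation ring by the columns of an invertible
   matrix. *)
Definition is_lattice (L : set 'cV[F]_2) : Prop :=
  exists2 B : 'M[F]_2, B \in unitmx &
    L = [set B *m x | x in [set x : 'cV[F]_2 |
           forall i, valuation_ring v (x i 0)]].

Definition homothety_class (L : set 'cV[F]_2) : set (set 'cV[F]_2) :=
  [set scale_set a L | a in [set a | a != 0]].

Definition bt_vertex : set (set (set 'cV[F]_2)) :=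
  [set homothety_class L | L in is_lattice].

Definition bt_adjacent (C C' : set (set 'cV[F]_2)) : Prop :=
  exists L L', [/\ C L, C' L', scale_set pi L `<` L' & L' `<` L].

Definition bt_edge : set (set (set (set 'cV[F]_2))) :=
  [set e | exists C C', [/\ bt_vertex C, bt_vertex C', bt_adjacent C C' &
                            e = [set C; C']]].

Definition bt_action (G : groupType) (rho : G -> 'M[F]_2) (x : G)
    (C : set (set 'cV[F]_2)) : set (set 'cV[F]_2) :=
  [set [set rho x *m u | u in L] | L in C].

End BruhatTitsTree.

Section RiemannSurface.
Variables (R : realType) (S : topologicalType).
Local Notation C := (R[i]^o).

(* Only the values of chart_map on chart_dom, and of chart_inv on the image of
   chart_dom, are meaningful. *)
Record chart := Chart {
  chart_dom : set S;
  chart_map : S -> C;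
  chart_inv : C -> S
}.

Definition chart_codom (f : chart) : set C := chart_map f @` chart_dom f.

Definition is_chart (f : chart) : Prop :=
  [/\ open (chart_dom f), open (chart_codom f),
      {within chart_dom f, continuous (chart_map f)},
      {within chart_codom f, continuous (chart_inv f)} &
      forall p, chart_dom f p -> chart_inv f (chart_map f p) = p].

(* Since the field of scalars is R[i], derivable means complex
   differentiable. *)
Definition holomorphic_on (D : set C) (f : C -> C) : Prop :=
  forall z, D z -> derivable f z 1.

Definition holomorphic_atlas (A : set chart) : Prop :=
  [/\ forall f, A f -> is_chart f,
      forall p, exists2 f, A f & chart_dom f p &
      forall f h, A f -> A h ->
        holomorphic_on (chart_map f @` (chart_dom f `&` chart_dom h))
          (fun z => chart_map h (chart_inv f z))].

Definition compact_riemann_surface : Prop :=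
  [/\ hausdorff_space S, compact [set: S], connected [set: S] &
      exists A, holomorphic_atlas A].

(* The closed disc in polar coordinates, the angle being rescaled to
   [0, 4g]: the boundary circle r = 1 is divided into 4g sides of length 1. *)
Definition polar_disc (g : nat) : set (R * R) :=
  [set p | 0 <= p.1 <= 1 /\ 0 <= p.2 <= (4 * g)%:R].

(* The equivalence relation on polar_disc g whose quotient is the regular
   4g-gon with sides identified in pairs along the word
   a_1 b_1 a_1^-1 b_1^-1 ... a_g b_g a_g^-1 b_g^-1. The first two constructors
   make polar coordinates into the disc; glue_a and glue_b identify sides 4k
   and 4k + 1 with the reversed sides 4k + 2 and 4k + 3. *)
Inductive polygon_glue (g : nat) : R * R -> R * R -> Prop :=
| glue_centre t t' :
    0 <= t <= (4 * g)%:R -> 0 <= t' <= (4 * g)%:R ->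
    polygon_glue g (0, t) (0, t')
| glue_angle r : 0 <= r <= 1 -> polygon_glue g (r, 0) (r, (4 * g)%:R)
| glue_a k s : (k < g)%N -> 0 <= s <= 1 ->
    polygon_glue g (1, (4 * k)%:R + s) (1, (4 * k + 3)%:R - s)
| glue_b k s : (k < g)%N -> 0 <= s <= 1 ->
    polygon_glue g (1, (4 * k + 1)%:R + s) (1, (4 * k + 4)%:R - s)
| glue_refl p : polygon_glue g p p
| glue_sym p q : polygon_glue g p q -> polygon_glue g q p
| glue_trans p q r :
    polygon_glue g p q -> polygon_glue g q r -> polygon_glue g p r.

(* S is homeomorphic to the closed orientable surface with g handles (g > 0),
   namely the quotient of the disc by polygon_glue g. When S is Hausdorff, q is
   a closed map since the disc is compact, so that the bijection it induces
   from the quotient to S is a homeomorphism. *)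
Definition has_genus (g : nat) : Prop :=
  exists q : R * R -> S,
    [/\ {within polar_disc g, continuous q}, q @` polar_disc g = [set: S] &
        forall x y, polar_disc g x -> polar_disc g y ->
          q x = q y <-> polygon_glue g x y].

End RiemannSurface.

Section FundamentalGroup.
Variables (R : realType) (S : topologicalType) (x0 : S).

(* Paths are functions on R of which only the restriction to [0, 1]
   matters. *)
Definition is_loop (f : R -> S) : Prop :=
  [/\ {within `[0, 1], continuous f}, f 0 = x0 & f 1 = x0].

Definition loop_homotopic (f h : R -> S) : Prop :=
  exists H : R * R -> S,
    [/\ {within `[0, 1] `*` `[0, 1], continuous H},
        forall t, 0 <= t <= 1 -> H (0, t) = f t,
        forall t, 0 <= t <= 1 -> H (1, t) = h t &
        forall s, 0 <= s <= 1 -> H (s, 0) = x0 /\ H (s, 1) = x0].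

Definition loop_concat (f h : R -> S) : R -> S :=
  fun t => if t <= 1 / 2 then f (2 * t) else h (2 * t - 1).

(* G is the group of homotopy classes of loops at x0, cls f being the class
   of f. *)
Definition fundamental_group (G : groupType) : Prop :=
  exists cls : (R -> S) -> G,
    [/\ forall x, exists2 f, is_loop f & cls f = x,
        forall f h, is_loop f -> is_loop h ->
          cls f = cls h <-> loop_homotopic f h &
        forall f h, is_loop f -> is_loop h ->
          cls (loop_concat f h) = (cls f * cls h)%g].

End FundamentalGroup.

(* Main.v *)
(* The loops c_i from the centre of the polygon to its i-th vertex and back from
   the 0-th vertex satisfy the relation of the surface group. The residue field
   being finite, every element fixing a vertex of the tree has a power fixing
   any given edge. Let psi be a homomorphism from Gamma onto the free group of
   rank two. If psi h is nontrivial for some h fixing a vertex, then suitable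
   conjugates of powers of psi h play ping-pong, and they lift to elements of
   Gamma fixing the edge. Otherwise psi kills all vertex stabilizers. Consider
   the two homomorphisms counting the crossings with two families of disjoint
   closed curves on the surface. One component of each gives two characters of
   Gamma whose cup product is nonzero on the surface relation. If both of them
   vanish on the vertex stabilizers, they have equivariant primitives on the
   vertices of the tree, and their cup product is a coboundary, a
   contradiction. *)
Require Import Defs.
From HB Require Import structures.
From mathcomp Require Import all_boot all_order all_algebra.
From mathcomp Require Import all_classical all_reals all_analysis.
From mathcomp Require Import ring lra zify.

Set Implicit Arguments.
Unset Strict Implicit.
Unset Printing Implicit Defensive.

Import Order.TTheory GRing.Theory Num.Theory.
Import numFieldNormedType.Exports.

Local Open Scope classical_set_scope.
Local Open Scope ring_scope.

(** * The free group of rank two *)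

(** No presentation of [Gamma] is established. The argument rests on relations that do hold in
    [Gamma], which come from explicit homotopies, and on homomorphisms out of it, which come as
    holonomy of locally constant cocycles. Each family of curves consists of one curve on each of
    two handles: disjointness lets the two crossings be sent to independent generators, hence onto a
    free group. The second family is the first one shifted by one side of the polygon, so that the
    two curves on handle 0 meet once; this is the source of the nonzero cup product. On the tree
    side the product is a coboundary because a tree has no cycles: the 1-form [t ds] built from the
    two primitives can be integrated. In the ping-pong step the exponents depend on the conjugators,
    since each conjugate fixes its own vertex; the conjugators must therefore work for all positive
    exponents at once. *)

Section ReducedWords.

Local Notation letter := ('I_2 * bool)%type.
Implicit Types (l : letter) (u v w : seq letter).

Definition letter_inv (l : letter) : letter := (l.1, ~~ l.2).

Lemma letter_invK : involutive letter_inv.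
Proof. by case=> i b; rewrite /letter_inv /= negbK. Qed.

Lemma letter_inv_neq l : l != letter_inv l.
Proof. by case: l => i b; rewrite /letter_inv xpair_eqE eqxx /=; case: b. Qed.

Lemma eq_letter_inv l l' : (l == letter_inv l') = (l' == letter_inv l).
Proof. by apply/eqP/eqP => ->; rewrite letter_invK. Qed.

Definition no_cancel (l l' : letter) := l' != letter_inv l.

Lemma reduced_wordE w : reduced_word w = sorted no_cancel w.
Proof.
apply: eq_sorted => -[i b] [j d]; rewrite /no_cancel /letter_inv xpair_eqE /=.
by rewrite (eq_sym j); case: (i == j); case: b; case: d.
Qed.

Definition ins l w :=
  if w is a :: w' then (if a == letter_inv l then w' else l :: w) else [:: l].

(** Words act on reduced words by inserting letters one at a time. Multiplication is this action,
    and associativity holds because inserting a letter and then its inverse is the identity on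
    reduced words (van der Waerden's device). *)
Definition wact w v := foldr ins v w.

Definition winv w := rev (map letter_inv w).

Lemma ins_sorted l w : sorted no_cancel w -> sorted no_cancel (ins l w).
Proof.
case: w => //= a w s; case: eqP => [_|/eqP na]; first exact: path_sorted s.
by rewrite /= /no_cancel na.
Qed.

Lemma wact_sorted w v : sorted no_cancel v -> sorted no_cancel (wact w v).
Proof. by move=> sv; elim: w => //= l w; exact: ins_sorted. Qed.

Lemma insK l w : sorted no_cancel w -> ins l (ins (letter_inv l) w) = w.
Proof.
case: w => [_|a w] /=; first by rewrite eqxx.
rewrite letter_invK; case: eqP => [->|_ _]; last by rewrite /= eqxx.
by case: w => //= b w /andP[/negbTE ->].
Qed.

Lemma insVK l w : sorted no_cancel w -> ins (letter_inv l) (ins l w) = w.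
Proof. by move=> sw; rewrite -{2}(letter_invK l) insK. Qed.

Lemma wact_ins l w v :
  sorted no_cancel v -> wact (ins l w) v = ins l (wact w v).
Proof.
move=> sv; case: w => //= a w; case: eqP => // ->.
by rewrite insK // wact_sorted.
Qed.

Lemma wactA u v w :
  sorted no_cancel w -> wact u (wact v w) = wact (wact u v) w.
Proof. by move=> sw; elim: u => //= l u ->; rewrite wact_ins. Qed.

Lemma wact_cat u v : sorted no_cancel (u ++ v) -> wact u v = u ++ v.
Proof.
elim: u => //= l u IH s; rewrite IH; last exact: path_sorted s.
by case: (u ++ v) s => //= a w /andP[/negbTE ->].
Qed.

Lemma winvK : involutive winv.
Proof.
move=> w; rewrite /winv map_rev revK -map_comp.
by rewrite (eq_map (g := id)) ?map_id // => l; rewrite /= letter_invK.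
Qed.

Lemma winv_sorted w : sorted no_cancel w -> sorted no_cancel (winv w).
Proof.
move=> sw; rewrite /winv rev_sorted sorted_map.
apply: sub_sorted sw => a b; rewrite /relpre /no_cancel /=.
by rewrite (inj_eq (can_inj letter_invK)) eq_letter_inv eq_sym.
Qed.

Lemma winv_cat u v : winv (u ++ v) = winv v ++ winv u.
Proof. by rewrite /winv map_cat rev_cat. Qed.

Lemma wact_winv w v : sorted no_cancel v -> wact (winv w) (wact w v) = v.
Proof.
move=> sv; elim: w => //= l w IH.
rewrite /winv /= rev_cons /wact -cats1 foldr_cat /=.
by rewrite insVK // wact_sorted.
Qed.

(** Reducedness is a condition on neighbouring letters, so an overlap that is not empty carries it
    from both halves to the whole. *)
Lemma sorted_overlap u v w : v != [::] -> sorted no_cancel (u ++ v) ->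
  sorted no_cancel (v ++ w) -> sorted no_cancel (u ++ v ++ w).
Proof.
case: v => // x v _; case: u => //= y u.
rewrite cat_path /= => /and3P[yu ux _] xvw.
by rewrite cat_path /= yu ux xvw.
Qed.

End ReducedWords.

Record free_group2 := FreeGroup2 {
  fword :> seq ('I_2 * bool);
  _ : sorted no_cancel fword
}.

HB.instance Definition _ := [isSub for fword].
HB.instance Definition _ := [Choice of free_group2 by <:].

Lemma fwordP (x : free_group2) : sorted no_cancel x.
Proof. by case: x. Qed.

Definition fg_one : free_group2 := @FreeGroup2 [::] isT.
Definition fg_mul (x y : free_group2) : free_group2 :=
  FreeGroup2 (wact_sorted x (fwordP y)).
Definition fg_inv (x : free_group2) : free_group2 :=
  FreeGroup2 (winv_sorted (fwordP x)).

Lemma fg_mulA : associative fg_mul.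
Proof. by move=> x y z; apply: val_inj; rewrite /= wactA ?fwordP. Qed.

Lemma fg_mul1 : left_id fg_one fg_mul.
Proof. by move=> x; apply: val_inj. Qed.

Lemma fg_mulr1 : right_id fg_one fg_mul.
Proof.
by move=> x; apply: val_inj; rewrite /= wact_cat cats0 ?fwordP.
Qed.

Lemma fg_mulV : left_inverse fg_one fg_inv fg_mul.
Proof.
move=> x; apply: val_inj => /=.
by rewrite -{2}[fword x]cats0 -wact_cat ?cats0 ?fwordP // wact_winv.
Qed.

Lemma fg_mulrV : right_inverse fg_one fg_inv fg_mul.
Proof.
move=> x; have -> : x = fg_inv (fg_inv x) by apply: val_inj; rewrite /= winvK.
have -> : fg_inv (fg_inv (fg_inv x)) = fg_inv x.
  by apply: val_inj; rewrite /= winvK.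
exact: fg_mulV.
Qed.

HB.instance Definition _ := isGroup.Build free_group2
  fg_mulA fg_mul1 fg_mulr1 fg_mulV fg_mulrV.

Lemma fword_inj : injective fword. Proof. exact: val_inj. Qed.
Lemma fword1 : fword 1%g = [::]. Proof. by []. Qed.
Lemma fwordM (x y : free_group2) : fword (x * y)%g = wact x y.
Proof. by []. Qed.
Lemma fwordV (x : free_group2) : fword (x^-1)%g = winv x.
Proof. by []. Qed.

Definition fg_gen (l : 'I_2 * bool) : free_group2 := @FreeGroup2 [:: l] isT.

Lemma fg_genV l : ((fg_gen l)^-1)%g = fg_gen (letter_inv l).
Proof. exact: val_inj. Qed.

(** Used to lift an element of the free group along a homomorphism: its word is evaluated at
    preimages of the generators. *)
Lemma word_val_fg (x : free_group2) :
  word_val (fun i => fg_gen (i, false)) x = x.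
Proof.
case: x => w sw; apply: val_inj => /=; elim: w sw => //= l w IH sw.
rewrite IH; last exact: path_sorted sw.
have -> : fword (letter_val (fun i => fg_gen (i, false)) l) = [:: l].
  by case: l {sw} => i [].
by rewrite (@wact_cat [:: l]).
Qed.

Lemma word_val_cons (G : groupType) (x : 'I_2 -> G) l w :
  word_val x (l :: w) = (letter_val x l * word_val x w)%g.
Proof. by []. Qed.

(** * Free pairs of conjugates of powers *)

Section FreeConjugates.
Local Open Scope group_scope.

Lemma exists_letter_notin (s : seq ('I_2 * bool)) :
  (size s < 4)%N -> exists l, l \notin s.
Proof.
move=> hs; apply/existsP; apply: contraLR hs; rewrite negb_exists -leqNgt.
move=> /forallP h; have <- : #|{: 'I_2 * bool}| = 4%N.
  by rewrite card_prod card_ord card_bool.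
apply: leq_trans (card_size s); apply: subset_leq_card.
by apply/fintype.subsetP => l _; have := h l; rewrite negbK.
Qed.

Variables (l : 'I_2 -> 'I_2 * bool) (K : 'I_2 -> seq ('I_2 * bool)).
Hypothesis l_inj : injective l.
Hypothesis K0 : forall i, K i != [::].
Hypothesis KK : forall i, sorted no_cancel (K i ++ K i).
Hypothesis lK : forall i, sorted no_cancel (l i :: K i).
Hypothesis Kl : forall i, sorted no_cancel (rcons (K i) (letter_inv (l i))).
Variable x : 'I_2 -> free_group2.
Hypothesis xE : forall i, x i = l i :: rcons (K i) (letter_inv (l i)) :> seq _.

Let K' (i : 'I_2) (b : bool) := if b then winv (K i) else K i.

Let K'0 i b : K' i b != [::].
Proof.
rewrite /K'; case: b => //; rewrite -size_eq0 /winv size_rev size_map size_eq0.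
exact: K0.
Qed.

Let KK' i b : sorted no_cancel (K' i b ++ K' i b).
Proof. by rewrite /K'; case: b => //; rewrite -winv_cat winv_sorted. Qed.

Let lK' i b : sorted no_cancel ([:: l i] ++ K' i b).
Proof.
rewrite /K'; case: b; last exact: lK.
have := winv_sorted (Kl i); rewrite -cats1 winv_cat.
by rewrite /winv /= letter_invK.
Qed.

Let K'l i b : sorted no_cancel (K' i b ++ [:: letter_inv (l i)]).
Proof.
rewrite /K'; case: b; last by rewrite cats1.
by have := winv_sorted (lK i); rewrite -cat1s winv_cat.
Qed.

Let xE' i b :
  letter_val x (i, b) = [:: l i] ++ K' i b ++ [:: letter_inv (l i)] :> seq _.
Proof.
rewrite /K' /letter_val; case: b; rewrite [X in X.2]/= ?fwordV xE -cats1 //.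
by rewrite -cat1s !winv_cat -catA /winv /= letter_invK.
Qed.

(* The conjugating letters never cancel, so the product begins as written. *)
Let word_val_starts w i b : sorted no_cancel ((i, b) :: w) ->
  exists s, word_val x ((i, b) :: w) = [:: l i] ++ K' i b ++ s :> seq _.
Proof.
elim: w i b => [|[j d] w IH] i b.
  by move=> _; exists [:: letter_inv (l i)]; rewrite word_val_cons mulg1 xE'.
move=> /andP[ij sw]; have [s sE] := IH j d sw.
have sV := fwordP (word_val x ((j, d) :: w)); rewrite sE in sV.
rewrite word_val_cons fwordM sE xE'.
(* If [i = j] the signs agree, the inner letters cancel and [K' i b] meets a copy of itself, which
   stays reduced since [K i] is cyclically reduced. If [i != j], injectivity of [l] prevents any
   cancellation. *)
have [eij|nij] := eqVneq i j.
  have edb : d = b.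
    move: ij; rewrite /no_cancel /letter_inv xpair_eqE eij eqxx /=.
    by case: (d); case: (b).
  subst j d; exists (K' i b ++ s).
  rewrite catA /wact foldr_cat /= eq_letter_inv eqxx.
  rewrite -[LHS]/(wact ([:: l i] ++ K' i b) (K' i b ++ s)).
  have s1 : sorted no_cancel (K' i b ++ s) by exact: path_sorted sV.
  have h := sorted_overlap (K'0 i b) (lK' i b) (KK' i b).
  have := @sorted_overlap ([:: l i] ++ K' i b) _ _ (K'0 i b) _ s1.
  by rewrite -!catA => /(_ h) {}h; rewrite wact_cat -?catA.
exists (letter_inv (l i) :: [:: l j] ++ K' j d ++ s).
rewrite wact_cat; last first.
  have h1 := sorted_overlap (K'0 i b) (lK' i b) (K'l i b).
  have h2 : sorted no_cancel ([:: letter_inv (l i)] ++ [:: l j] ++ K' j d ++ s).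
    rewrite [sorted _ _]/= {1}/no_cancel letter_invK.
    by rewrite (contra_neq (@l_inj _ _)) 1?eq_sym //=.
  have := @sorted_overlap ([:: l i] ++ K' i b) [:: letter_inv (l i)] _ isT _ h2.
  by rewrite -!catA; exact.
by rewrite -!catA.
Qed.

Lemma ping_pong_freely_independent : freely_independent x.
Proof.
case=> [|[i b] w]; rewrite // reduced_wordE => /word_val_starts[s sE] _ h.
by move: sE; rewrite h.
Qed.

End FreeConjugates.

Lemma conj_expg (G : groupType) (a b : G) n :
  ((a * b * a^-1) ^+ n = a * b ^+ n * a^-1)%g.
Proof.
have E z : (a * z * a^-1 = z ^ (a^-1))%g by rewrite conjgE invgK mulgA.
by rewrite !E conjXg.
Qed.

Section FreePowers.
Local Open Scope group_scope.

(** By induction on the length: as long as the last letter is the inverse of the first, conjugation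
    strips both. What remains is never empty, since the word is reduced. *)
Lemma conj_cyclically_reduced (h : free_group2) : h != 1 ->
  exists g : free_group2, let k := fword (g * h * g^-1) in
    k != [::] /\ sorted no_cancel (k ++ k).
Proof.
move: {-1}(size h) (leqnn (size h)) => n; elim: n h => [|n IH] h.
  rewrite leqn0 size_eq0 => /eqP h0 /eqP []; exact: val_inj.
move=> sz h1; have sh := fwordP h.
case E : (fword h) => [|a m]; first by case/eqP: h1; apply: fword_inj.
case/lastP: m E => [|m z] E.
  exists 1; rewrite mul1g invg1 mulg1 E; split => //=.
  by rewrite andbT /no_cancel letter_inv_neq.
have [ez|nz] := eqVneq z (letter_inv a); last first.
  exists 1; rewrite mul1g invg1 mulg1; split; first by rewrite E.
  rewrite E in sh; rewrite E cat_cons /= cat_path [path _ a (rcons _ _)]sh /=.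
  by rewrite last_rcons [path _ a (rcons _ _)]sh /no_cancel -eq_letter_inv nz.
subst z; have sm : sorted no_cancel m.
  move: sh; rewrite E /= -cats1 => /path_sorted.
  by case: (m) => //= y r; rewrite cat_path => /andP[].
pose M := FreeGroup2 sm.
have hE : h = fg_gen a * M * (fg_gen a)^-1.
  rewrite -mulgA fg_genV; apply: fword_inj; rewrite !fwordM /= E.
  rewrite wact_cat cats1; first last.
    by rewrite E in sh; exact: path_sorted sh.
  have := @wact_cat [:: a] (rcons m (letter_inv a)).
  by rewrite cat1s -E => /(_ sh).
have M1 : M != 1.
  apply/eqP => /(congr1 fword) /= m0; move: sh; rewrite E m0 /=.
  by rewrite /no_cancel eqxx.
have szM : (size M <= n)%N.
  by move: sz; rewrite E /= size_rcons ltnS; apply: leq_trans.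
have [g gP] := IH M szM M1; exists (g * (fg_gen a)^-1).
by rewrite hE invgM invgK !mulgA !mulgVK.
Qed.

(** At each seam of the power the last letter of [k] meets the first one, as in [k ++ k], so nothing
    cancels. *)
Lemma fword_expg (k : free_group2) n : sorted no_cancel (k ++ k) ->
  (k != [::] :> seq _) -> (0 < n)%N ->
  (exists s, k ^+ n = k ++ s :> seq _) /\
  (exists s, k ^+ n = s ++ k :> seq _).
Proof.
move=> kk k0; case: n => // n _; elim: n => [|n [[s sE] [t tE]]].
  by rewrite expg1; split; exists [::]; rewrite ?cats0.
have kE : (k ^+ n.+2)%g = k ++ k ++ s :> seq _.
  rewrite expgS fwordM sE wact_cat // sorted_overlap //.
  by rewrite -sE fwordP.
split; first by exists (k ++ s).
by exists (k ++ t); rewrite kE -sE tE catA.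
Qed.

(** The conjugators are chosen before the exponents: the power needed to fix an edge is only known
    once the conjugate is. *)
Lemma conj_powers_freely_independent (h : free_group2) : h != 1 ->
  exists g : 'I_2 -> free_group2, forall n : 'I_2 -> nat,
    (forall i, 0 < n i)%N ->
    freely_independent (fun i => g i * h ^+ n i * (g i)^-1).
Proof.
move=> /conj_cyclically_reduced[g [k0 kk]]; set k := g * h * g^-1 in k0 kk.
have [a [s1 aE]] : exists a s1, fword k = a :: s1.
  by case: (fword k) k0 => // a s _; exists a, s.
have [z [s2 zE]] : exists z s2, fword k = rcons s2 z.
  by case/lastP: (fword k) k0 => // s y _; exists y, s.
(* For the conjugate of [k] by a letter to be reduced as written, the letter must differ from the
   inverse of the first letter of [k] and from its last letter; the second choice also avoids the
   first. Four letters leave room for this. *)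
have [l0] := @exists_letter_notin [:: letter_inv a; z] isT.
rewrite !inE => /norP[l0a l0z].
have [l1] := @exists_letter_notin [:: letter_inv a; z; l0] isT.
rewrite !inE => /norP[l1a /norP[l1z l10]].
pose l (i : 'I_2) := if i == ord0 then l0 else l1.
have la i : l i != letter_inv a by rewrite /l; case: ifP.
have lz i : l i != z by rewrite /l; case: ifP.
have l_inj : injective l.
  move=> i j; rewrite /l; case: (eqVneq i); case: (eqVneq j) => //.
  - by move=> -> ->.
  - by move=> _ _ e; rewrite e eqxx in l10.
  - by move=> _ _ e; rewrite e eqxx in l10.
  - case: i j => [[|[|//]] hi] [[|[|//]] hj] //= _ _ _; exact: val_inj.
have lk i : sorted no_cancel ([:: l i] ++ k).
  have := fwordP k; rewrite aE /= => ->.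
  by rewrite /no_cancel eq_letter_inv la.
have kl i : sorted no_cancel (k ++ [:: letter_inv (l i)]).
  have := fwordP k; rewrite zE -cats1 -catA /=.
  have zl : no_cancel z (letter_inv (l i)).
    by rewrite /no_cancel (inj_eq (can_inj letter_invK)).
  case: (s2) => [|y s] /=; first by rewrite zl.
  by rewrite !cat_path /= => /and3P[-> -> _]; rewrite zl.
exists (fun i => fg_gen (l i) * g) => n n0.
have hE i : fg_gen (l i) * g * h ^+ n i * (fg_gen (l i) * g)^-1 =
            fg_gen (l i) * k ^+ n i * (fg_gen (l i))^-1.
  by rewrite /k conj_expg invgM !mulgA.
have kN0 i : fword (k ^+ n i) != [::].
  have [[s ->] _] := fword_expg kk k0 (n0 i).
  by case: (fword k) k0.
have sk i : sorted no_cancel ([:: l i] ++ k ^+ n i).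
  have [[s sE] _] := fword_expg kk k0 (n0 i).
  by rewrite sE sorted_overlap // -sE fwordP.
have ks i : sorted no_cancel (k ^+ n i ++ [:: letter_inv (l i)]).
  have [_ [s sE]] := fword_expg kk k0 (n0 i).
  by rewrite sE -catA sorted_overlap // -sE fwordP.
apply: (@ping_pong_freely_independent l (fun i => fword (k ^+ n i))) => // i.
- have [[s sE] [t tE]] := fword_expg kk k0 (n0 i).
  rewrite {1}tE sE -catA; apply: sorted_overlap => //.
    by rewrite -tE fwordP.
  by apply: sorted_overlap => //; rewrite -sE fwordP.
- by rewrite -cats1.
rewrite hE -mulgA fg_genV !fwordM /= wact_cat //.
by have := wact_cat (sorted_overlap (kN0 i) (sk i) (ks i)); rewrite cats1.
Qed.

End FreePowers.

Section ExponentSum.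

(** Only the first generator is counted. The values are rational because the 1-form integrated on
    the tree involves a factor 1/2. *)
Definition letter_exp (l : 'I_2 * bool) : rat :=
  if l.1 == ord0 then (if l.2 then -1 else 1) else 0.

Definition exponent_sum (x : free_group2) : rat :=
  \sum_(l <- fword x) letter_exp l.

Lemma letter_exp_inv l : letter_exp (letter_inv l) = - letter_exp l.
Proof.
case: l => i b; rewrite /letter_exp /=.
by case: (i == _); case: b; rewrite /= ?opprK ?oppr0.
Qed.

Lemma exponent_sumM x y :
  exponent_sum (x * y)%g = exponent_sum x + exponent_sum y.
Proof.
rewrite /exponent_sum fwordM; elim: (fword x) => [|l w IH] /=.
  by rewrite big_nil add0r.
rewrite big_cons -addrA -IH; case: (wact w y) => [|a v] /=.
  by rewrite big_cons.
case: eqP => [->|_]; last by rewrite big_cons.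
by rewrite big_cons letter_exp_inv addNKr.
Qed.

End ExponentSum.

(** * Actions on trees and cup products *)

Section TreeAction.
Variables (V : choiceType) (eqv adj : V -> V -> Prop) (lev : V -> nat).

(* Vertices are the classes of eqv; lev is the distance to a root. *)
Definition rooted_tree : Prop :=
  [/\ [/\ (forall u, eqv u u), (forall u w, eqv u w -> eqv w u) &
          (forall u w z, eqv u w -> eqv w z -> eqv u z)],
      [/\ (forall u w, adj u w -> adj w u),
          (forall u u' w, eqv u u' -> adj u w -> adj u' w) &
          (forall u u', eqv u u' -> lev u = lev u')],
      (forall u w, adj u w -> lev w = (lev u).+1 \/ lev u = (lev w).+1) &
      [/\ (forall u u', lev u = 0%N -> lev u' = 0%N -> eqv u u'),
          (forall u, (0 < lev u)%N -> exists2 w, adj u w & lev u = (lev w).+1) &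
          (forall u w w', adj u w -> adj u w' -> lev u = (lev w).+1 ->
             lev u = (lev w').+1 -> eqv w w')]].

Hypothesis tree : rooted_tree.

Lemma tree_connected (T : Type) (f : V -> T) :
  (forall u w, eqv u w -> f u = f w) -> (forall u w, adj u w -> f u = f w) ->
  forall u w, f u = f w.
Proof.
case: tree => _ _ _ [root parent _] fe fa u w.
have down n x : lev x = n -> exists2 y, lev y = 0%N & f x = f y.
  elim: n x => [|n IH] x lx; first by exists x.
  have [|y xy lxy] := parent x; first by rewrite lx.
  have [|z lz fz] := IH y; first by move: lxy; rewrite lx => -[].
  by exists z => //; rewrite (fa _ _ xy).
have [x lx ->] := down _ u erefl; have [y ly ->] := down _ w erefl.
exact/fe/root.
Qed.

(** Sum the form along the path to the root. Parents are unique up to [eqv], so the choice [p] is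
    harmless and the sum changes by [w] along every edge. *)
Lemma tree_one_form_exact (w : V -> V -> rat) :
  (forall x x' y, eqv x x' -> w x y = w x' y) ->
  (forall x y, w y x = - w x y) ->
  exists s : V -> rat, (forall x y, eqv x y -> s x = s y) /\
    forall x y, adj x y -> s y = s x + w x y.
Proof.
case: tree => [[er es et] [asym ae le] alev [root parent uniqp]] we wN.
have we2 x y y' : eqv y y' -> w x y = w x y'.
  by move=> /we e; rewrite wN e -wN.
have [p pP] : {p : V -> V & forall u, (0 < lev u)%N ->
    adj u (p u) /\ lev u = (lev (p u)).+1}.
  apply: (@choice V V (fun u x => (0 < lev u)%N ->
    adj u x /\ lev u = (lev x).+1)) => u.
  by have [u0|] := posnP (lev u);
    [exists u | case/parent => x ux lx; exists x].
pose fix S n x {struct n} := if n is m.+1 then S m (p x) + w (p x) x else 0.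
pose s x := S (lev x) x.
have Se n x y : lev x = n -> eqv x y -> S n x = S n y.
  elim: n x y => //= n IH x y lx xy.
  have ly : lev y = n.+1 by rewrite -(le _ _ xy).
  have [|ax ex] := pP x; first by rewrite lx.
  have [|ay ey] := pP y; first by rewrite ly.
  have pxy : eqv (p x) (p y).
    by apply: (@uniqp x) => //; [exact: ae (es _ _ xy) ay | rewrite lx -ly].
  rewrite (IH _ (p y)) //; last by move: ex; rewrite lx => -[].
  by rewrite (we _ _ _ pxy) (we2 _ _ _ xy).
have se x y : eqv x y -> s x = s y.
  by move=> xy; rewrite /s (le _ _ xy) (Se _ x y) // (le _ _ xy).
have up x y : adj x y -> lev y = (lev x).+1 -> s y = s x + w x y.
  move=> xy ly; rewrite {1}/s ly /=.
  have [|ay ey] := pP y; first by rewrite ly.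
  have pxy : eqv (p y) x by apply: (@uniqp y) => //; exact: asym.
  by rewrite (we _ _ _ pxy) (Se _ (p y) x) //; move: ey; rewrite ly => -[].
exists s; split => // x y xy.
have [|lx] := alev _ _ xy; first exact: up.
by rewrite (up _ _ (asym _ _ xy) lx) (wN x y) subrK.
Qed.

Variables (Gamma : groupType) (act : Gamma -> V -> V).

Definition tree_action : Prop :=
  [/\ (forall u, act 1%g u = u),
      (forall x y u, act (x * y)%g u = act x (act y u)),
      (forall x u w, eqv u w -> eqv (act x u) (act x w)) &
      (forall x u w, adj u w -> adj (act x u) (act x w))].

Hypothesis tact : tree_action.

(** On each orbit put [t u = a (b u)], where [b u] carries a base point of the orbit to [u]. Two
    such elements differ by a stabilizer, on which [a] vanishes. *)
Lemma equivariant_potential (u0 : V) (a : Gamma -> rat) :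
  (forall x y, a (x * y)%g = a x + a y) ->
  (forall x u, eqv (act x u) u -> a x = 0) ->
  exists t : V -> rat, (forall u w, eqv u w -> t u = t w) /\
    forall x u, t (act x u) = t u + a x.
Proof.
case: tree tact => [[er es et] _ _ _] [act1 actM acte _] aM a0.
pose orb u := [set w | exists x, eqv (act x w) u].
have a1 : a 1%g = 0 by apply: (addrI (a 1%g)); rewrite -aM mulg1 addr0.
have aV x : a (x^-1)%g = - a x.
  by apply: (addrI (a x)); rewrite -aM mulgV a1 subrr.
have orbu u : orb u u by exists 1%g; rewrite act1.
(* The choice depends on the set [orb u] only, so all points of one orbit get the same base
   point. *)
pose r u := xget u0 (orb u).
have rP u : orb u (r u) by exact: (xgetPex u0 (ex_intro _ u (orbu u))).
have [b bP] := choice rP.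
have r_eq u w x : eqv (act x u) w -> r u = r w.
  move=> h; suff e : orb u = orb w by rewrite /r e.
  apply/seteqP; split=> z [y hy].
    by exists (x * y)%g; rewrite actM; apply: et h; exact: acte.
  exists (x^-1 * y)%g; rewrite actM; apply: et (acte _ _ _ hy) _.
  by have := acte x^-1%g _ _ h; rewrite -actM mulVg act1; exact: es.
have key u w x : eqv (act x u) w -> a (b w) = a (b u) + a x.
  move=> h; have e := r_eq _ _ _ h.
  have : a ((b w)^-1 * (x * b u))%g = 0.
    apply: (a0 _ (r u)); rewrite actM.
    have h1 : eqv (act (x * b u)%g (r u)) w.
      by rewrite actM; apply: et h; exact: acte.
    apply: et (acte _ _ _ h1) _; rewrite e.
    have := acte (b w)^-1%g _ _ (bP w); rewrite -actM mulVg act1; exact: es.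
  by rewrite !aM aV; lra.
exists (fun u => a (b u)); split.
  by move=> u w uw; rewrite (key u w 1%g) ?act1 // a1 addr0.
by move=> x u; rewrite (key u (act x u) x).
Qed.

(* Both characters, hence their cup product, are pulled back from the tree. *)
Lemma cup_product_coboundary (u0 : V) (a b : Gamma -> rat) :
  (forall x y, a (x * y)%g = a x + a y) ->
  (forall x y, b (x * y)%g = b x + b y) ->
  (forall x u, eqv (act x u) u -> a x = 0) ->
  (forall x u, eqv (act x u) u -> b x = 0) ->
  exists k : Gamma -> rat,
    forall x y, k (x * y)%g = k x + k y + a x * b y.
Proof.
move=> aM bM a0 b0.
have [t [te tM]] := equivariant_potential u0 aM a0.
have [s [se sM]] := equivariant_potential u0 bM b0.
(* The integral of [t ds] over an edge by the trapezoid rule: antisymmetric, and translation by a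
   group element [z] adds [a z * (s y - s x)], an exact form. *)
pose w x y := 2^-1 * (t x + t y) * (s y - s x).
have [f [fe fw]] : exists f : V -> rat, (forall x y, eqv x y -> f x = f y) /\
    forall x y, adj x y -> f y = f x + w x y.
  apply: tree_one_form_exact.
    by move=> x x' y h; rewrite /w (te _ _ h) (se _ _ h).
  by move=> x y; rewrite /w; ring.
have [_ actM acte acta] := tact.
(* The defect of invariance of [f], corrected by [a x * s], is constant along edges; its value is
   the cochain sought. *)
pose h x u := f (act x u) - f u - a x * s u.
have hc x u v : h x u = h x v.
  apply: tree_connected u v => u v uv.
    by rewrite /h (fe _ _ (acte x _ _ uv)) (fe _ _ uv) (se _ _ uv).
  rewrite /h (fw _ _ (acta x _ _ uv)) (fw _ _ uv) /w !tM !sM.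
  by field.
exists (fun x => h x u0) => x y.
rewrite (hc x u0 (act y u0)) /h actM !sM aM; ring.
Qed.

End TreeAction.

(* The relations of c make the product of the commutators of
   c (4k+1) c (4k+2)^-1 and c (4k+3) c (4k+2)^-1 trivial in Gamma. The classes
   a and b have a nonzero cup product on this relation. *)
Lemma surface_cup_product_neq0 (Gamma : groupType) (g : nat)
    (c : nat -> Gamma) (a b k : Gamma -> rat) :
  (0 < g)%N -> c 0%N = 1%g -> c (4 * g)%N = 1%g ->
  (forall i, (i < g)%N ->
     (c (4 * i)%N * (c (4 * i + 3)%N)^-1
      = c (4 * i + 1)%N * (c (4 * i + 2)%N)^-1)%g) ->
  (forall i, (i < g)%N ->
     (c (4 * i + 1)%N * (c (4 * i + 4)%N)^-1
      = c (4 * i + 2)%N * (c (4 * i + 3)%N)^-1)%g) ->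
  (forall x y, a (x * y)%g = a x + a y) ->
  (forall x y, b (x * y)%g = b x + b y) ->
  (forall i, (i <= 4 * g)%N -> a (c i) = ((i == 1) || (i == 2))%N%:R) ->
  (forall i, (i <= 4 * g)%N -> b (c i) = ((i == 2) || (i == 3))%N%:R) ->
  (forall x y, k (x * y)%g = k x + k y + a x * b y) -> False.
Proof.
move=> g0 c0 cg ra rb aM bM ac bc kM.
have a1 : a 1%g = 0 by apply: (addrI (a 1%g)); rewrite -aM mulg1 addr0.
have aV x : a (x^-1)%g = - a x.
  by apply: (addrI (a x)); rewrite -aM mulgV a1 subrr.
have b1 : b 1%g = 0 by apply: (addrI (b 1%g)); rewrite -bM mulg1 addr0.
have bV x : b (x^-1)%g = - b x.
  by apply: (addrI (b x)); rewrite -bM mulgV b1 subrr.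
have k1 : k 1%g = 0.
  by have := kM 1%g 1%g; rewrite mulg1 a1 mul0r; lra.
have kF x y : k (x * y^-1)%g = k x - k y + a y * b y - a x * b y.
  have := kM y y^-1%g; rewrite mulgV k1 kM bV; lra.
(* Passing from vertex [4 * i] to vertex [4 * i + 4] adds the cup product on handle [i], which is 1
   for [i = 0] and 0 otherwise. Once round the polygon, [k 1] would have to be 1. *)
have step i : (i < g)%N ->
    k (c (4 * i + 4)%N) = k (c (4 * i)%N) + (i == 0%N)%:R.
  move=> ig; have := congr1 k (ra _ ig); have := congr1 k (rb _ ig).
  rewrite !kF !ac ?bc; try lia.
  case: i ig => [|i] ig /=.
    rewrite !muln0 /= => h1 h2; lra.
  have e n : (4 * i.+1 + n == 1)%N = false by lia.
  have e0 : (4 * i.+1 == 1)%N = false by lia.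
  have e2 n : (4 * i.+1 + n == 2)%N = false by lia.
  have e3 n : (n < 4)%N -> (4 * i.+1 + n == 3)%N = false by lia.
  have e4 : (4 * i.+1 + 4 == 3)%N = false by lia.
  by rewrite !e !e2 e4 !e3 ?e0 //= => h1 h2; lra.
have all_k i : (i < g)%N -> k (c (4 * i.+1)%N) = 1.
  elim: i => [|i IH] ig; rewrite mulnS addnC step ?muln0 ?c0 ?k1 ?add0r //.
  by rewrite IH ?addr0 //; lia.
have := all_k g.-1; rewrite prednK // leqnn => /(_ isT).
by rewrite cg k1 => /eqP; rewrite eq_sym oner_eq0.
Qed.

(** * The tree of SL2 *)

Lemma ord2_ind (P : 'I_2 -> Prop) : P 0 -> P 1 -> forall i, P i.
Proof.
move=> P0 P1 [[|[|//]] hi].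
  by have -> : Ordinal hi = 0 by apply: val_inj.
by have -> : Ordinal hi = 1 by apply: val_inj.
Qed.

(** * Determinant and adjugate of 2 by 2 matrices *)

Section Matrix22.
Variable R : comNzRingType.
Implicit Types A B : 'M[R]_2.

Lemma mulmx22 A B i j : (A *m B) i j = A i 0 * B 0 j + A i 1 * B 1 j.
Proof.
rewrite mxE !big_ord_recl big_ord0 addr0.
by congr (_ + A _ _ * B _ _); apply: val_inj.
Qed.

Lemma det_mx22 A : \det A = A 0 0 * A 1 1 - A 0 1 * A 1 0.
Proof.
rewrite (expand_det_row A 0) !big_ord_recl big_ord0 addr0 /cofactor.
rewrite !det_mx11 !mxE /= expr0 mul1r expr1 mulN1r mulrN.
by congr (A _ _ * A _ _ - A _ _ * A _ _); apply: val_inj.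
Qed.

(** The adjugate by its entries: those of [A], moved or negated, so that lower bounds on valuations
    pass to it, as they need not to [invmx A]. *)
Definition adj22 A : 'M[R]_2 :=
  \matrix_(i, j) if i == j then A (rev_ord i) (rev_ord i) else - A i j.

Lemma rev_ord2 : (rev_ord (0 : 'I_2) = 1) * (rev_ord (1 : 'I_2) = 0).
Proof. by split; apply: val_inj. Qed.

Lemma mul_adj22 A : adj22 A *m A = (\det A)%:M.
Proof.
apply/matrixP => i j; rewrite mulmx22 !mxE det_mx22.
elim/ord2_ind: i; elim/ord2_ind: j; rewrite /= !rev_ord2 ?mulr1n ?mulr0n; ring.
Qed.

Lemma mul22_adj A : A *m adj22 A = (\det A)%:M.
Proof.
apply/matrixP => i j; rewrite mulmx22 !mxE det_mx22.
elim/ord2_ind: i; elim/ord2_ind: j; rewrite /= !rev_ord2 ?mulr1n ?mulr0n; ring.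
Qed.

Lemma det_adj22 A : \det (adj22 A) = \det A.
Proof. by rewrite !det_mx22 !mxE /= !rev_ord2; ring. Qed.

Lemma adj22K A : adj22 (adj22 A) = A.
Proof.
apply/matrixP => i j; rewrite !mxE rev_ordK !eqxx.
by case: eqP => [->|]; rewrite ?opprK.
Qed.

End Matrix22.

Lemma invmx22 (F : fieldType) (A : 'M[F]_2) : A \in unitmx ->
  invmx A = (\det A)^-1 *: adj22 A.
Proof.
move=> uA; have := mul_adj22 A => /(congr1 (mulmx^~ (invmx A))).
rewrite -mulmxA mulmxV // mulmx1 => ->.
by rewrite mul_scalar_mx scalerA mulVf ?scale1r // -unitfE -unitmxE.
Qed.

(** * Valuations of matrices and distances in the tree *)

Section Valuation.
Variables (F : fieldType) (v : F -> int) (pi : F).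
Hypothesis (hv : discrete_valuation v) (hpi : uniformizer v pi).

Local Notation e := (v pi).
Implicit Types (A B M N : 'M[F]_2).
Implicit Types (a x y t : F).

Lemma valuationM x y : x != 0 -> y != 0 -> v (x * y) = v x + v y.
Proof. by case: hv => h _; exact: h. Qed.

Lemma valuation1 : v 1 = 0.
Proof.
have h1 : 1 != 0 :> F by exact: oner_neq0.
by have := valuationM h1 h1; rewrite mulr1; lia.
Qed.

Lemma valuationN x : v (- x) = v x.
Proof.
have [->|x0] := eqVneq x 0; first by rewrite oppr0.
have h1 : -1 != 0 :> F by rewrite oppr_eq0 oner_neq0.
have := valuationM h1 h1; rewrite mulrNN mulr1 valuation1 => h.
by rewrite -[- x]mulN1r valuationM //; lia.
Qed.

Lemma valuationV x : x != 0 -> v x^-1 = - v x.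
Proof.
move=> x0; have := valuationM x0 (invr_neq0 x0).
by rewrite mulfV // valuation1; lia.
Qed.

Lemma uniformizer_neq0 : pi != 0. Proof. by case: hpi. Qed.
Lemma uniformizer_gt0 : 0 < e. Proof. by case: hpi. Qed.

Lemma valuationX x n : x != 0 -> v (x ^+ n) = v x *+ n.
Proof.
move=> x0; elim: n => [|n IH]; first by rewrite expr0 valuation1.
by rewrite exprS valuationM ?expf_neq0 // IH mulrS.
Qed.

Lemma valuationXz x n : x != 0 -> v (x ^ n) = v x * n.
Proof.
move=> x0; case: n => n.
  by rewrite -exprnP valuationX // -mulr_natr natz.
rewrite NegzE -exprnN valuationV ?expf_neq0 // valuationX //.
by rewrite mulrN -mulr_natr natz.
Qed.

(** Multiplying by a power of [pi] makes the Euclidean remainder itself a valuation, which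
    minimality of [e] forces to be 0. Distances are therefore measured in units of [e]. *)
Lemma dvdz_valuation x : x != 0 -> (e %| v x)%Z.
Proof.
move=> x0; case: hpi => p0 e0 emin.
pose y := x * pi ^ (- (v x %/ e)%Z).
have y0 : y != 0 by rewrite mulf_neq0 // expfz_neq0.
have vy : v y = (v x %% e)%Z.
  rewrite valuationM ?expfz_neq0 // valuationXz //.
  by have := divz_eq (v x) e; lia.
have := modz_ge0 (v x) (lt0r_neq0 e0); have := ltz_pmod (v x) e0.
rewrite -vy => h1 h2; apply/dvdz_mod0P; rewrite -vy.
have := emin _ y0; lia.
Qed.

(* The valuation of 0 is infinite. *)
Definition vge x k := x = 0 \/ k <= v x.

Lemma vge0 k : vge 0 k. Proof. by left. Qed.

Lemma vgeD x y k : vge x k -> vge y k -> vge (x + y) k.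
Proof.
move=> [->|xk]; first by rewrite add0r.
move=> [->|yk]; first by rewrite addr0; right.
have [x0|x0] := eqVneq x 0; first by rewrite x0 add0r; right.
have [y0|y0] := eqVneq y 0; first by rewrite y0 addr0; right.
have [s0|s0] := eqVneq (x + y) 0; first by left.
case: hv => _ /(_ _ _ x0 y0 s0); rewrite ge_min.
by case/orP => h; right; [exact: le_trans xk h | exact: le_trans yk h].
Qed.

Lemma vgeN x k : vge x k -> vge (- x) k.
Proof. by case=> [->|h]; [left; rewrite oppr0 | right; rewrite valuationN]. Qed.

Lemma vgeB x y k : vge x k -> vge y k -> vge (x - y) k.
Proof. by move=> hx /vgeN; exact: vgeD. Qed.

Lemma vgeM x y k l : vge x k -> vge y l -> vge (x * y) (k + l).
Proof.
move=> [->|xk]; first by rewrite mul0r; left.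
move=> [->|yk]; first by rewrite mulr0; left.
have [x0|x0] := eqVneq x 0; first by rewrite x0 mul0r; left.
have [y0|y0] := eqVneq y 0; first by rewrite y0 mulr0; left.
by right; rewrite valuationM // lerD.
Qed.

Lemma vge_le x k l : l <= k -> vge x k -> vge x l.
Proof. by move=> lk [->|h]; [left | right; exact: le_trans h]. Qed.

Lemma vgeMl x y k : y != 0 -> vge (y * x) (v y + k) -> vge x k.
Proof.
move=> y0 [/eqP|h]; first by rewrite mulf_eq0 (negPf y0) => /eqP ->; left.
have [->|x0] := eqVneq x 0; first by left.
by right; move: h; rewrite valuationM // lerD2l.
Qed.

(** The least valuation of an entry. For the zero matrix no [k] qualifies and the default 0 is
    returned. *)
Definition mxval (M : 'M[F]_2) : int :=
  xget 0 [set k | (forall i j, vge (M i j) k) /\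
                  exists i j, M i j != 0 /\ v (M i j) = k].

Lemma mxvalP M : M != 0 -> (forall i j, vge (M i j) (mxval M)) /\
  exists i j, M i j != 0 /\ v (M i j) = mxval M.
Proof.
move=> M0.
have [[i j] ij0] : exists ij : 'I_2 * 'I_2, M ij.1 ij.2 != 0.
  apply/existsP; apply: contraNT M0; rewrite negb_exists => /forallP h.
  apply/eqP/matrixP => i j; rewrite mxE.
  by have := h (i, j); rewrite negbK => /eqP.
pose P (ij : 'I_2 * 'I_2) := M ij.1 ij.2 != 0.
pose f (ij : 'I_2 * 'I_2) := v (M ij.1 ij.2).
have [[a b] Pab abmin] := @Order.TotalTheory.arg_minP _ int _ (i, j) P f ij0.
apply: (@xgetPex _ 0 [set k | (forall i j, vge (M i j) k) /\
                  exists i j, M i j != 0 /\ v (M i j) = k]).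
exists (v (M a b)); split; last by exists a, b.
move=> r s; have [->|rs0] := eqVneq (M r s) 0; first exact: vge0.
by right; exact: (abmin (r, s)).
Qed.

Lemma le_mxval M k : M != 0 -> (forall i j, vge (M i j) k) -> k <= mxval M.
Proof.
move=> /mxvalP[_ [i [j [ij0 <-]]]] /(_ i j) [h|//].
by rewrite h eqxx in ij0.
Qed.

Lemma unit22_neq0 (M : 'M[F]_2) : M \in unitmx -> M != 0.
Proof.
move=> uM; apply/eqP => M0; move: uM.
by rewrite unitmxE unitfE M0 det0 ?eqxx.
Qed.

Lemma unit22_det (M : 'M[F]_2) : M \in unitmx -> \det M != 0.
Proof. by rewrite unitmxE unitfE. Qed.

Lemma mxval_mul A B : A \in unitmx -> B \in unitmx ->
  mxval A + mxval B <= mxval (A *m B).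
Proof.
move=> uA uB; have [hA _] := mxvalP (unit22_neq0 uA).
have [hB _] := mxvalP (unit22_neq0 uB).
apply: le_mxval => [|i j]; first by rewrite unit22_neq0 // unitmx_mul uA.
by rewrite mulmx22; apply: vgeD; exact: vgeM.
Qed.

Lemma mxvalZ a A : a != 0 -> A \in unitmx -> mxval (a *: A) = v a + mxval A.
Proof.
move=> a0 uA; have [hA [i [j [ij0 ijE]]]] := mxvalP (unit22_neq0 uA).
have aA0 : a *: A != 0 by rewrite scaler_eq0 negb_or a0 unit22_neq0.
have [haA _] := mxvalP aA0.
apply/eqP; rewrite eq_le; apply/andP; split; last first.
  by apply: le_mxval => // r s; rewrite mxE; apply: vgeM => //; right.
have := haA i j; rewrite mxE -ijE -valuationM //.
by case=> // /eqP; rewrite mulf_eq0 (negPf a0) (negPf ij0).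
Qed.

Lemma unit_adj22 (A : 'M[F]_2) : (adj22 A \in unitmx) = (A \in unitmx).
Proof. by rewrite !unitmxE det_adj22. Qed.

Lemma mxval_adj A : A \in unitmx -> mxval (adj22 A) = mxval A.
Proof.
have ge B : B \in unitmx -> mxval B <= mxval (adj22 B).
  move=> uB; have [hB _] := mxvalP (unit22_neq0 uB).
  apply: le_mxval => [|i j]; first by rewrite unit22_neq0 ?unit_adj22.
  by rewrite mxE; case: ifP => _ //; exact: vgeN.
move=> uA; apply/eqP; rewrite eq_le ge // andbT.
by rewrite -{2}(adj22K A) ge // unit_adj22.
Qed.

(* [vdist (A^-1 B)] is the distance between the vertices A and B of the tree,
   scaled by the valuation of the uniformizer. *)
Definition vdist (M : 'M[F]_2) : int := v (\det M) - 2 * mxval M.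

Lemma vdist_ge0 M : M \in unitmx -> 0 <= vdist M.
Proof.
move=> uM; have [hM _] := mxvalP (unit22_neq0 uM).
have : vge (\det M) (mxval M + mxval M).
  by rewrite det_mx22; apply: vgeB; exact: vgeM.
case=> [h|]; last by rewrite /vdist; lia.
by have := unit22_det uM; rewrite h eqxx.
Qed.

Lemma dvdz_mxval M : M \in unitmx -> (e %| mxval M)%Z.
Proof.
by move=> /unit22_neq0/mxvalP[_ [i [j [h <-]]]]; exact: dvdz_valuation.
Qed.

Lemma dvdz_vdist M : M \in unitmx -> (e %| vdist M)%Z.
Proof.
move=> uM; rewrite /vdist rpredB //; last by rewrite dvdz_mull ?dvdz_mxval.
by rewrite dvdz_valuation ?unit22_det.
Qed.

Lemma vdist1 : vdist 1%:M = 0.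
Proof.
have u1 : (1%:M : 'M[F]_2) \in unitmx by exact: unitmx1.
have m0 : 0 <= mxval 1%:M.
  apply: le_mxval => [|i j]; first exact: unit22_neq0.
  by rewrite mxE; case: eqP => _; [right; rewrite valuation1 | left].
by have := vdist_ge0 u1; rewrite /vdist det1 valuation1; lia.
Qed.

Lemma vdistZ a M : a != 0 -> M \in unitmx -> vdist (a *: M) = vdist M.
Proof.
move=> a0 uM.
have -> : vdist (a *: M) = v (\det (a *: M)) - 2 * (v a + mxval M).
  by rewrite /vdist mxvalZ.
have -> : v (\det (a *: M)) = v a + v a + v (\det M).
  by rewrite detZ valuationM ?expf_neq0 ?unit22_det // valuationX // mulr2n.
rewrite /vdist; lia.
Qed.

Lemma vdist_adj M : M \in unitmx -> vdist (adj22 M) = vdist M.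
Proof. by move=> uM; rewrite /vdist mxval_adj // det_adj22. Qed.

Lemma vdistV M : M \in unitmx -> vdist (invmx M) = vdist M.
Proof.
move=> uM; rewrite invmx22 // vdistZ ?unit_adj22 ?vdist_adj //.
by rewrite invr_neq0 ?unit22_det.
Qed.

Lemma vdet_mul A B : A \in unitmx -> B \in unitmx ->
  v (\det (A *m B)) = v (\det A) + v (\det B).
Proof. by move=> uA uB; rewrite det_mulmx valuationM ?unit22_det. Qed.

(** This is [mxval_mul] for [adj22 A] and [A *m B], whose product is [\det A *: B]. *)
Lemma mxval_mul_le A B : A \in unitmx -> B \in unitmx ->
  mxval (A *m B) + mxval A <= v (\det A) + mxval B.
Proof.
move=> uA uB; have uAB : A *m B \in unitmx by rewrite unitmx_mul uA.
rewrite -mxvalZ ?unit22_det // -mul_scalar_mx -mul_adj22 -mulmxA addrC.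
by rewrite -[X in X + _](mxval_adj uA) mxval_mul ?unit_adj22.
Qed.

Lemma mxval_mul_ler A B : A \in unitmx -> B \in unitmx ->
  mxval (A *m B) + mxval B <= v (\det B) + mxval A.
Proof.
move=> uA uB; have uAB : A *m B \in unitmx by rewrite unitmx_mul uA.
rewrite -mxvalZ ?unit22_det // -mul_mx_scalar -mul22_adj mulmxA.
by rewrite -[X in _ + X](mxval_adj uB) mxval_mul ?unit_adj22.
Qed.

Lemma vdist_mul0l A B : A \in unitmx -> B \in unitmx -> vdist A = 0 ->
  vdist (A *m B) = vdist B.
Proof.
move=> uA uB; have := mxval_mul uA uB; have := mxval_mul_le uA uB.
by rewrite /vdist vdet_mul //; lia.
Qed.

Lemma vdist_mul0r A B : A \in unitmx -> B \in unitmx -> vdist B = 0 ->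
  vdist (A *m B) = vdist A.
Proof.
move=> uA uB; have := mxval_mul uA uB; have := mxval_mul_ler uA uB.
by rewrite /vdist vdet_mul //; lia.
Qed.

(** The lower and upper bounds on [mxval (A *m N)] are [e] apart and all values are multiples of
    [e], so one of the bounds is attained; the distance cannot stay equal. *)
Lemma vdist_neighbour A N : A \in unitmx -> N \in unitmx -> vdist N = e ->
  vdist (A *m N) = vdist A + e \/ vdist A = vdist (A *m N) + e.
Proof.
move=> uA uN dN; have h1 := mxval_mul uA uN; have h2 := mxval_mul_ler uA uN.
have uAN : A *m N \in unitmx by rewrite unitmx_mul uA.
have := dvdz_mxval uA; have := dvdz_mxval uN; have := dvdz_mxval uAN.
move=> /dvdzP[a aE] /dvdzP[b bE] /dvdzP[d dE].
move: dN; rewrite /vdist vdet_mul // aE bE dE => dN.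
rewrite aE bE dE in h1 h2; have e0 := uniformizer_gt0.
have : a = b + d \/ a = b + d + 1 by nia.
by case=> ->; [left|right]; lia.
Qed.

(** Let [A i j] be an entry of least valuation. A column operation clears the rest of row [i], and
    column [j] is multiplied by [pi]. The one remaining entry is [\det A / A i j] up to sign, and it
    gains the required [e] because the distance is at least [e]. *)
Lemma vdist_parent A : A \in unitmx -> 0 < vdist A ->
  exists N, [/\ N \in unitmx, vdist N = e & vdist A = vdist (A *m N) + e].
Proof.
move=> uA dA; have [hA [i [j [ij0 ijE]]]] := mxvalP (unit22_neq0 uA).
have edA : e <= vdist A.
  have /dvdzP[q qE] := dvdz_vdist uA.
  rewrite qE in dA *; rewrite ler_peMl ?(ltW uniformizer_gt0) //.
  by move: dA; rewrite pmulr_lgt0 ?uniformizer_gt0 //; lia.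
pose t := A i (rev_ord j) / A i j.
pose N : 'M[F]_2 := \matrix_(r, s)
  if s == j then (if r == j then pi else 0) else (if r == j then - t else 1).
have ht : vge t 0.
  rewrite /t mulrC; apply: (@vgeMl _ (A i j)) => //.
  by rewrite mulrA mulfV // mul1r addr0 ijE.
have NE : \det N = pi /\ forall r, (A *m N) r j = A r j * pi /\
    (A *m N) r (rev_ord j) = A r (rev_ord j) - t * A r j.
  rewrite det_mx22 !mxE; split.
    by elim/ord2_ind: (j); rewrite /=; ring.
  move=> r; rewrite !mulmx22 !mxE.
  by elim/ord2_ind: (j); rewrite /= !rev_ord2 /=; split; ring.
have [detN ANE] := NE.
have uN : N \in unitmx by rewrite unitmxE detN unitfE uniformizer_neq0.
have mN : mxval N = 0.
  have N0 := unit22_neq0 uN; have [hN _] := mxvalP N0.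
  apply/eqP; rewrite eq_le; apply/andP; split.
    have : N (rev_ord j) (rev_ord j) = 1.
      by rewrite mxE; elim/ord2_ind: (j); rewrite /= ?rev_ord2.
    have := hN (rev_ord j) (rev_ord j) => /[swap] ->.
    by case=> [/eqP|]; rewrite ?oner_eq0 ?valuation1.
  apply: le_mxval => // r s; rewrite mxE.
  case: ifP => _; case: ifP => _.
  - by right; exact/ltW/uniformizer_gt0.
  - exact: vge0.
  - exact: vgeN.
  - by right; rewrite valuation1.
have dN : vdist N = e by rewrite /vdist detN mN; lia.
exists N; split => //.
have uAN : A *m N \in unitmx by rewrite unitmx_mul uA.
have : mxval A + e <= mxval (A *m N).
  apply: le_mxval => [|r s]; first exact: unit22_neq0.
  have [->|sj] := eqVneq s j.
    by rewrite (ANE r).1; apply: vgeM => //; right.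
  have -> : s = rev_ord j.
    by move: sj; elim/ord2_ind: s; elim/ord2_ind: (j); rewrite // rev_ord2.
  rewrite (ANE r).2.
  apply: (@vgeMl _ (A i j)) => //.
  have -> : A i j * (A r (rev_ord j) - t * A r j) =
            A i j * A r (rev_ord j) - A i (rev_ord j) * A r j.
    by rewrite /t; field.
  have hdet : vge (\det A) (v (A i j) + (mxval A + e)).
    by right; rewrite ijE; move: edA; rewrite /vdist; lia.
  have [ri|ri] := eqVneq r i.
    by rewrite ri mulrC subrr; exact: vge0.
  have -> : r = rev_ord i.
    by move: ri; elim/ord2_ind: r; elim/ord2_ind: (i); rewrite // rev_ord2.
  move: hdet; rewrite det_mx22 => hdet.
  have hdetN := vgeN hdet; rewrite opprB in hdetN.
  elim/ord2_ind: (i) hdet hdetN; elim/ord2_ind: (j); rewrite !rev_ord2 => h1 h2.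
  - by [].
  - by [].
  - by rewrite (mulrC (A 1 0)) (mulrC (A 1 1)).
  - by rewrite (mulrC (A 1 0)) (mulrC (A 1 1)).
case: (vdist_neighbour uA uN dN) => //; rewrite /vdist vdet_mul //.
by move: dN; rewrite /vdist mN; have := uniformizer_gt0; lia.
Qed.

(** Modulo [pi] and after scaling, the columns of [N] and of [N'] lie in the kernel of one nonzero
    row of [A], a line. Hence the determinants formed by a column of each gain an extra [e]; up to
    sign they are the entries of [adj22 N *m N']. *)
Lemma vdist_parent_unique A N N' : A \in unitmx -> N \in unitmx ->
  N' \in unitmx -> vdist N = e -> vdist N' = e ->
  vdist A = vdist (A *m N) + e -> vdist A = vdist (A *m N') + e ->
  vdist (invmx N *m N') = 0.
Proof.
move=> uA uN uN' dN dN' dAN dAN'.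
have up X : X \in unitmx -> vdist X = e -> vdist A = vdist (A *m X) + e ->
    mxval (A *m X) = mxval A + mxval X + e.
  by move=> uX; rewrite /vdist vdet_mul //; lia.
have mN := up _ uN dN dAN; have mN' := up _ uN' dN' dAN'.
have [hN _] := mxvalP (unit22_neq0 uN).
have [hN' _] := mxvalP (unit22_neq0 uN').
have unz X : X \in unitmx -> A *m X != 0.
  by move=> uX; rewrite unit22_neq0 // unitmx_mul uA.
have [hAN _] := mxvalP (unz _ uN); have [hAN' _] := mxvalP (unz _ uN').
have [hA [i [j [ij0 ijE]]]] := mxvalP (unit22_neq0 uA).
have key (a b : 'I_2) : vge (N 0 a * N' 1 b - N 1 a * N' 0 b)
    (mxval N + mxval N' + e).
  have ha := hAN i a; have hb := hAN' i b.
  rewrite mulmx22 mN in ha; rewrite mulmx22 mN' in hb.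
  apply: (@vgeMl _ (A i j)) => //; rewrite ijE.
  have hK x y z w : vge x (mxval A + mxval N + e) -> vge y (mxval N') ->
      vge z (mxval A + mxval N' + e) -> vge w (mxval N) ->
      vge (x * y - z * w) (mxval A + (mxval N + mxval N' + e)).
    move=> hx hy hz hw.
    by apply: vgeB; [apply: vge_le (vgeM hx hy) | apply: vge_le (vgeM hz hw)];
      lia.
  have h1 := hK _ _ _ _ ha (hN' 1 b) hb (hN 1 a).
  have h0 := vgeN (hK _ _ _ _ ha (hN' 0 b) hb (hN 0 a)).
  move: h0 h1; elim/ord2_ind: (j) => h0 h1.
    by congr vge: h1; ring.
  by congr vge: h0; ring.
have uM : adj22 N *m N' \in unitmx by rewrite unitmx_mul unit_adj22 uN.
have le : mxval N + mxval N' + e <= mxval (adj22 N *m N').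
  apply: le_mxval => [|a b]; first exact: unit22_neq0.
  rewrite mulmx22 !mxE; elim/ord2_ind: a; rewrite /= !rev_ord2.
    by rewrite (_ : _ + _ = N' 0 b * N 1 1 - N' 1 b * N 0 1); [|ring];
      have := vgeN (key 1 b); rewrite opprB [N 1 _ * _]mulrC [N 0 _ * _]mulrC.
  by rewrite (_ : _ + _ = N 0 0 * N' 1 b - N 1 0 * N' 0 b); [|ring].
have dd : vdist (invmx N *m N') = vdist (adj22 N *m N').
  by rewrite invmx22 // -scalemxAl vdistZ // invr_eq0 unit22_det.
rewrite dd; apply/eqP; rewrite eq_le vdist_ge0 // andbT.
have dE : \det (adj22 N) = \det N by exact: det_adj22.
move: dN dN'; rewrite /vdist vdet_mul ?unit_adj22 // dE; lia.
Qed.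

End Valuation.

(** * The Bruhat-Tits tree on frames *)

Section BTTree.
Variables (F : fieldType) (v : F -> int) (pi : F).
Hypothesis (hv : discrete_valuation v) (hpi : uniformizer v pi).

(** Vertices are handled through bases, with [frame_eqv] for homothetic lattices: left
    multiplication then acts strictly, and the distance depends on the change of basis alone. *)
Definition frame := {M : 'M[F]_2 | M \in unitmx}.

Definition frame_eqv (u w : frame) : Prop :=
  vdist v (invmx (val u) *m val w) = 0.
Definition frame_adj (u w : frame) : Prop :=
  vdist v (invmx (val u) *m val w) = v pi.
Definition frame_lev (u : frame) : nat := `|(vdist v (val u) %/ v pi)%Z|%N.

Let frameV (u : frame) : invmx (val u) \in unitmx.
Proof. by rewrite unitmx_inv (valP u). Qed.

Let frameVM (u w : frame) : invmx (val u) *m val w \in unitmx.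
Proof. by rewrite unitmx_mul frameV (valP w). Qed.

Lemma frame_levP u : vdist v (val u) = (frame_lev u)%:Z * v pi.
Proof.
have := dvdz_vdist hv hpi (valP u) => /dvdzP[q qE].
have e0 := uniformizer_gt0 hpi.
have := vdist_ge0 hv (valP u); rewrite /frame_lev qE mulzK ?gt_eqF //.
by rewrite pmulr_lge0 // => q0; rewrite gez0_abs.
Qed.

Lemma frame_mulE (u w z : frame) : invmx (val u) *m val z =
  (invmx (val u) *m val w) *m (invmx (val w) *m val z).
Proof. by rewrite -mulmxA mulKVmx ?(valP w). Qed.

Lemma frame_invE (u w : frame) :
  invmx (val u) *m val w = invmx (invmx (val w) *m val u).
Proof.
apply: (can_inj (mulKmx (frameVM w u))); rewrite -frame_mulE.
by rewrite mulVmx ?(valP w) // mulmxV.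
Qed.

Lemma frame_lev_inj (u : frame) n :
  vdist v (val u) = n%:Z * v pi -> frame_lev u = n.
Proof.
have e0 := uniformizer_gt0 hpi.
by rewrite frame_levP => /(mulIf (lt0r_neq0 e0)) [].
Qed.

(** The root is the identity frame; a parent is obtained by right multiplication with the matrix of
    [vdist_parent]. *)
Lemma bruhat_tits_rooted_tree : rooted_tree frame_eqv frame_adj frame_lev.
Proof.
have e0 := uniformizer_gt0 hpi.
have sym (u w : frame) :
    vdist v (invmx (val u) *m val w) = vdist v (invmx (val w) *m val u).
  by rewrite frame_invE vdistV.
have valE (u w : frame) : val w = val u *m (invmx (val u) *m val w).
  by rewrite mulKVmx ?(valP u).
split.
- split.
  + by move=> u; rewrite /frame_eqv mulVmx ?(valP u) // vdist1.
  + by move=> u w; rewrite /frame_eqv sym.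
  + by move=> u w z uw wz; rewrite /frame_eqv (frame_mulE u w) vdist_mul0l.
- split.
  + by move=> u w; rewrite /frame_adj sym.
  + move=> u u' w uu'; rewrite /frame_adj (frame_mulE u' u).
    by rewrite (vdist_mul0l hv (frameVM u' u) (frameVM u w)) // sym.
  + move=> u u' uu'; apply: frame_lev_inj.
    have := frame_levP u'; rewrite {1}(valE u u').
    by rewrite vdist_mul0r ?(valP u) ?frameVM.
- move=> u w uw; have := vdist_neighbour hv hpi (valP u) (frameVM u w) uw.
  rewrite -valE => -[h|h]; [left|right]; apply: frame_lev_inj;
    by rewrite h frame_levP; lia.
- split.
  + move=> u u' lu lu'.
    rewrite /frame_eqv vdist_mul0l ?frameV ?(valP u') ?vdistV ?(valP u) //.
      by rewrite frame_levP lu' mul0r.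
    by rewrite frame_levP lu mul0r.
  + move=> u lu; have [|N [uN dN dE]] := vdist_parent hv hpi (valP u).
      by rewrite frame_levP; nia.
    have uw : val u *m N \in unitmx by rewrite unitmx_mul (valP u).
    pose w : frame := exist _ (val u *m N) uw.
    exists w; first by rewrite /frame_adj /= mulKmx ?(valP u).
    apply: frame_lev_inj; rewrite dE.
    by have := frame_levP w; rewrite /= => ->; lia.
  + move=> u w w' uw uw' lw lw'.
    have h x : frame_adj u x -> frame_lev u = (frame_lev x).+1 ->
        vdist v (val u) = vdist v (val u *m (invmx (val u) *m val x)) + v pi.
      by move=> _ lx; rewrite -valE !frame_levP lx; lia.
    rewrite /frame_eqv (frame_mulE w u) (frame_invE w u).
    have := @vdist_parent_unique _ _ _ hv _ _ _ (valP u) (frameVM u w)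
      (frameVM u w') uw uw' (h _ uw lw) (h _ uw' lw').
    by [].
Qed.

Variables (Gamma : groupType) (rho : Gamma -> 'M[F]_2).
Hypothesis hrho : SL2_representation rho.

Lemma rep_unit x : rho x \in unitmx.
Proof. by rewrite unitmxE hrho.1 unitr1. Qed.

Lemma rep1 : rho 1%g = 1%:M.
Proof.
apply: (can_inj (mulKmx (rep_unit 1%g))).
by rewrite -hrho.2 mulg1 mulmx1.
Qed.

Lemma frame_act_subproof x (u : frame) : rho x *m val u \in unitmx.
Proof. by rewrite unitmx_mul rep_unit (valP u). Qed.

Definition frame_act x (u : frame) : frame :=
  exist _ (rho x *m val u) (frame_act_subproof x u).

Lemma frame_actP : tree_action frame_eqv frame_adj frame_act.
Proof.
have h x (u w : frame) : invmx (val (frame_act x u)) *m val (frame_act x w) =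
    invmx (val u) *m val w.
  rewrite /= -[RHS]mul1mx; apply: (can_inj (mulKmx (valP (frame_act x u)))).
  rewrite mulKVmx ?frame_act_subproof // mul1mx /=.
  by rewrite -mulmxA mulKVmx ?(valP u).
split.
- by move=> u; apply: val_inj; rewrite /= rep1 mul1mx.
- by move=> x y u; apply: val_inj; rewrite /= hrho.2 mulmxA.
- by move=> x u w; rewrite /frame_eqv h.
- by move=> x u w; rewrite /frame_adj h.
Qed.

End BTTree.

(** * Powers in vertex stabilizers *)

Section Powers.
Variables (F : fieldType) (v : F -> int) (pi : F).
Hypothesis (hv : discrete_valuation v) (hpi : uniformizer v pi).
Hypothesis hfin : finite_set (residue_field v).
Implicit Types (A B M N X Y : 'M[F]_2).

Local Notation e := (v pi).

Lemma residue_index : exists n (r : F -> 'I_n.+1), forall x y,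
  vge v x 0 -> vge v y 0 -> r x = r y -> vge v (x - y) e.
Proof.
have /finite_setP[n] := hfin; rewrite card_eq_le => /andP[/pcard_leP[f] _].
pose coset x := [set x + y | y in maximal_ideal v].
exists n, (fun x => inord (f (coset x))) => x y x0 y0 fxy.
have cin z : vge v z 0 -> coset z \in residue_field v.
  by move=> z0; apply/mem_set; exists z.
have flt z : vge v z 0 -> (f (coset z) < n)%N.
  by move=> /cin/set_mem hz; have := @funS _ _ _ _ f _ hz.
have e1 : f (coset x) = f (coset y).
  by move/(congr1 val): fxy; rewrite /= !inordK // ltnS ltnW // flt.
have cxy : coset x = coset y.
  exact: 'inj_f (cin _ x0) (cin _ y0) e1.
have [d dm <-] : coset y x.
  by rewrite -cxy; exists 0; [left | rewrite addr0].
rewrite addrAC subrr add0r; case: dm => [->|d0]; [exact: vge0|].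
have [->|dn0] := eqVneq d 0; first exact: vge0.
by right; case: hpi => _ _; exact.
Qed.

Lemma residue_pigeonhole (I : finType) (f : nat -> I -> F) :
  (forall k i, vge v (f k i) 0) ->
  exists k l, (k < l)%N /\ forall i, vge v (f l i - f k i) e.
Proof.
move=> f0; have [n [r rP]] := residue_index.
pose N := #|{ffun I -> 'I_n.+1}|.
pose h (k : 'I_N.+1) : {ffun I -> 'I_n.+1} := [ffun i => r (f k i)].
have : ~~ injectiveb h.
  by apply/negP => /injectiveP /leq_card; rewrite card_ord ltnn.
case/injectivePn => k [l kl hkl].
have hE i : r (f k i) = r (f l i).
  by move/(congr1 (fun g : {ffun _ -> _} => g i)): hkl; rewrite !ffunE.
have [lt|lt|/val_inj eq] := ltngtP k l; last by rewrite eq eqxx in kl.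
  by exists k, l; split => // i; exact: rP.
by exists l, k; split => // i; exact: rP.
Qed.

(** Two natural numbers have the same residue; their difference [q] stands in for the residue
    characteristic. *)
Lemma natr_vge : exists2 q, (0 < q)%N & vge v q%:R e.
Proof.
have n0 n : vge v (n%:R : F) 0.
  elim: n => [|n IH]; first exact: vge0.
  by rewrite -natr1; apply: vgeD => //; right; rewrite valuation1.
have [k [l [kl /(_ tt) h]]] :=
  @residue_pigeonhole unit (fun n _ => n%:R) (fun n _ => n0 n).
by exists (l - k)%N; rewrite ?subn_gt0 // natrB // ltnW.
Qed.

Definition mxvge M k := forall i j, vge v (M i j) k.

Lemma mxvgeD M N k : mxvge M k -> mxvge N k -> mxvge (M + N) k.
Proof. by move=> hM hN i j; rewrite mxE; exact: vgeD. Qed.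

Lemma mxvgeM M N k l : mxvge M k -> mxvge N l -> mxvge (M *m N) (k + l).
Proof.
by move=> hM hN i j; rewrite mulmx22; apply: vgeD => //; exact: vgeM.
Qed.

Lemma mxvge_le M k l : l <= k -> mxvge M k -> mxvge M l.
Proof. by move=> lk hM i j; exact: vge_le (hM i j). Qed.

Lemma mxvge_adj M k : mxvge M k -> mxvge (adj22 M) k.
Proof. by move=> hM i j; rewrite mxE; case: ifP => _ //; exact: vgeN. Qed.

Lemma mxvge_scalar a k : vge v a k -> mxvge a%:M k.
Proof. by move=> ha i j; rewrite mxE; case: eqP => _ //; exact: vge0. Qed.

Lemma mxvge1 : mxvge 1 0.
Proof. by apply: mxvge_scalar; right; rewrite valuation1. Qed.

Lemma mxvgeX M n : mxvge M 0 -> mxvge (M ^+ n) 0.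
Proof.
move=> hM; elim: n => [|n IH]; first exact: mxvge1.
by rewrite exprS -mulmxE; have := mxvgeM hM IH; rewrite addr0.
Qed.

Lemma mxvge_sum n (f : nat -> 'M[F]_2) k :
  (forall i, mxvge (f i) k) -> mxvge (\sum_(i < n) f i) k.
Proof.
move=> hf; elim: n => [|n IH]; last by rewrite big_ord_recr; exact: mxvgeD.
by rewrite big_ord0 => i j; rewrite mxE; exact: vge0.
Qed.

Lemma mxvge_subX1 X n k : mxvge X 0 -> mxvge (X - 1) k -> mxvge (X ^+ n - 1) k.
Proof.
move=> X0 Xk; rewrite subrX1 -mulmxE -(addr0 k); apply: mxvgeM => //.
by apply: (@mxvge_sum n (fun i => X ^+ i)) => i; exact: mxvgeX.
Qed.

(** Pigeonhole modulo [pi] gives a power congruent to 1. If [Y] is congruent to 1, then [Y ^+ q - 1]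
    is [Y - 1] times a sum of [q] terms congruent to 1, hence congruent to [q] and so to 0: each
    further exponent [q] gains at least [e]. *)
Lemma unipotent_power X k : mxvge X 0 -> \det X = 1 ->
  exists2 n, (0 < n)%N & mxvge (X ^+ n - 1) k.
Proof.
move=> X0 detX; have e0 := uniformizer_gt0 hpi.
have [q q0 qe] := natr_vge.
suff key m : exists2 n, (0 < n)%N & mxvge (X ^+ n - 1) (e *+ m.+1).
  have [n n0 hn] := key `|k|%N; exists n => //; apply: mxvge_le hn.
  by rewrite -mulr_natr natz; nia.
elim: m => [|m [n n0 IH]].
  have h k' (ij : 'I_2 * 'I_2) : vge v ((X ^+ k') ij.1 ij.2) 0.
    exact: mxvgeX.
  have [i [j [ij hij]]] := residue_pigeonhole h.
  exists (j - i)%N; first by rewrite subn_gt0.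
  have XL : adj22 X * X = 1 by rewrite -mulmxE mul_adj22 detX.
  have XLn l : adj22 X ^+ l * X ^+ l = 1.
    elim: l => [|l IH]; first by rewrite !expr0 mulr1.
    by rewrite exprSr exprS mulrA -(mulrA (_ ^+ l)) XL mulr1.
  have -> : X ^+ (j - i) - 1 = adj22 X ^+ i *m (X ^+ j - X ^+ i).
    by rewrite mulmxE mulrBr XLn -{2}(subnKC (ltnW ij)) exprD mulrA XLn mul1r.
  rewrite mulr1n -[e]add0r; apply: mxvgeM; first exact/mxvgeX/mxvge_adj.
  by move=> r s; have := hij (r, s); rewrite !mxE.
exists (n * q)%N; first by rewrite muln_gt0 n0.
have Xn0 := mxvgeX n X0.
rewrite exprM subrX1 -mulmxE mulrSr; apply: mxvgeM => //.
have -> : \sum_(i < q) (X ^+ n) ^+ i =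
    \sum_(i < q) ((X ^+ n) ^+ i - 1) + q%:R%:M.
  have -> : q%:R%:M = 1 *+ q :> 'M[F]_2 by rewrite raddfMn.
  rewrite big_split /= sumr_const card_ord.
  by rewrite mulNrn subrK.
apply: mxvgeD; last exact: mxvge_scalar.
apply: (@mxvge_sum q (fun i => (X ^+ n) ^+ i - 1)) => i.
apply: mxvge_subX1 => //; apply: mxvge_le IH.
by rewrite mulrSr lerDr mulrn_wge0 // ltW.
Qed.

Lemma mx_pow_conj (N X : 'M[F]_2) n : N \in unitmx ->
  (invmx N *m X *m N) ^+ n = invmx N *m X ^+ n *m N.
Proof.
move=> uN; elim: n => [|n IH]; first by rewrite !expr0 mulmx1 mulVmx.
by rewrite !exprS IH -!mulmxE -!mulmxA mulKVmx.
Qed.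

(** In the basis [M] the matrix is integral, so some power of it is close to 1, and closeness
    absorbs the denominators of the change of basis [P] to [N]. *)
Lemma vertex_stabilizer_power X (M N : frame F) : \det X = 1 ->
  vdist v (invmx (val M) *m X *m val M) = 0 ->
  exists2 n, (0 < n)%N & mxvge (invmx (val N) *m X ^+ n *m val N) 0.
Proof.
move=> detX; set K := (invmx _ *m _ *m _) => dK.
have uM := valP M; have uN := valP N; rewrite /= in uM uN.
have detK : \det K = 1.
  by rewrite !det_mulmx detX mulr1 -det_mulmx mulVmx // det1.
have uK : K \in unitmx by rewrite unitmxE detK unitr1.
have K0 : mxvge K 0.
  have [hK _] := mxvalP v (unit22_neq0 uK).
  move=> i j; apply: vge_le (hK i j).
  by move: dK; rewrite /vdist detK valuation1 //; lia.
pose P := invmx (val M) *m val N.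
have uP : P \in unitmx by rewrite unitmx_mul unitmx_inv uM.
have uP' : invmx P \in unitmx by rewrite unitmx_inv.
have [hP _] := mxvalP v (unit22_neq0 uP).
have [hP' _] := mxvalP v (unit22_neq0 uP').
have [n n0 hn] := unipotent_power (- (mxval v P + mxval v (invmx P))) K0 detK.
exists n => //.
have -> : invmx (val N) *m X ^+ n *m val N =
    invmx P *m (K ^+ n - 1) *m P + 1.
  have EP : invmx P = invmx (val N) *m val M.
    apply: (can_inj (mulKmx uP)); rewrite mulmxV // /P -mulmxA.
    by rewrite (mulKVmx uN) mulVmx.
  rewrite mulmxBr mulmxBl mulmx1 mulVmx // subrK mx_pow_conj // EP /P.
  by rewrite -!mulmxA (mulKVmx uM) mulmxA (mulKVmx uM) -!mulmxA.
apply: mxvgeD; last exact: mxvge1.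
have := mxvgeM (mxvgeM hP' hn) hP; apply: mxvge_le; lia.
Qed.

End Powers.

(** * Parallel transport on the fundamental group *)

Section Lebesgue.
Variable R : realType.

(** Lebesgue's number. The property concerns triples because the cocycle identity does; for pairs
    the third point is ignored. *)
Lemma lebesgue_triple (X : pseudoMetricType R) (K : set X)
    (Q : X -> X -> X -> Prop) : compact K ->
  (forall z, K z -> exists2 e : R, 0 < e & forall z1 z2 z3,
     K z1 -> K z2 -> K z3 -> ball z e z1 -> ball z e z2 -> ball z e z3 ->
     Q z1 z2 z3) ->
  exists2 e : R, 0 < e & forall z z1 z2 z3,
     K z -> K z1 -> K z2 -> K z3 -> ball z e z1 -> ball z e z2 ->
     ball z e z3 -> Q z1 z2 z3.
Proof.
move=> /compact_near_coveringP cK loc.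
pose P (e : R) (z : X) := forall z1 z2 z3,
     K z1 -> K z2 -> K z3 -> ball z e z1 -> ball z e z2 -> ball z e z3 ->
     Q z1 z2 z3.
have : \forall e \near (0 : R)^'+, K `<=` P e.
  apply: cK => z Kz; have [e e0 he] := loc z Kz.
  exists (ball z (e / 2), [set d | d < e / 2]) => /=.
    split; first by apply: nbhsx_ballx; rewrite divr_gt0.
    by apply: nbhs_right_lt; rewrite divr_gt0.
  move=> [z' d] /= [zz' de] z1 z2 z3 K1 K2 K3 b1 b2 b3.
  have h y : ball z' d y -> ball z e y.
    move=> b; rewrite [e]splitr; apply: ball_triangle zz' _.
    by apply: le_ball b; exact: ltW.
  by apply: he => //; exact: h.
move=> near_e; near (0 : R)^'+ => e.
exists e; first by near: e; exact: nbhs_right_gt.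
move=> z z1 z2 z3 Kz; move: z1 z2 z3.
have : K `<=` P e by near: e.
exact.
Unshelve. all: by end_near. Qed.

Definition cell (N i : nat) (t : R) : bool :=
  (i%:R <= t * N%:R) && (t * N%:R <= i.+1%:R).

Lemma cell_refine N M i t : (0 < M)%N -> cell (N * M) i t ->
  cell N (i %/ M) t.
Proof.
move=> M0; rewrite /cell natrM mulrA => /andP[h1 h2].
have M0' : 0 < M%:R :> R by rewrite ltr0n.
apply/andP; split.
  by rewrite -(ler_pM2r M0') (le_trans _ h1) // -natrM ler_nat leq_trunc_div.
by rewrite -(ler_pM2r M0') (le_trans h2) // -natrM ler_nat ltn_ceil.
Qed.

Lemma cell01 N i t : (i < N)%N -> cell N i t -> 0 <= t <= 1.
Proof.
move=> iN /andP[h1 h2]; have N0 : 0 < N%:R :> R by rewrite ltr0n; lia.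
apply/andP; split.
  by rewrite -(ler_pM2r N0) mul0r (le_trans _ h1).
by rewrite -(ler_pM2r N0) mul1r (le_trans h2) // ler_nat.
Qed.

Lemma cell_left N i : (0 < N)%N -> cell N i (i%:R / N%:R).
Proof.
move=> N0; rewrite /cell mulfVK ?pnatr_eq0 -?lt0n // lexx.
by rewrite ler_nat leqnSn.
Qed.

Lemma cell_right N i : (0 < N)%N -> cell N i (i.+1%:R / N%:R).
Proof.
move=> N0; rewrite /cell mulfVK ?pnatr_eq0 -?lt0n // lexx.
by rewrite ler_nat leqnSn.
Qed.

Lemma cell_ball (e : R) : 0 < e -> exists2 N, (0 < N)%N &
  forall i t, cell N i t -> ball (i%:R / N%:R : R) e t.
Proof.
move=> e0; pose N := (Num.truncn e^-1).+1.
have eN : e^-1 < N%:R by rewrite /N truncnS_gt.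
exists N => // i t /andP[h1 h2].
have N0 : 0 < N%:R :> R by rewrite ltr0n.
rewrite /ball /= ltr_distlC; have tE : t = t * N%:R / N%:R.
  by rewrite mulfK // gt_eqF.
have eNN : N%:R^-1 < e by rewrite invf_plt // posrE.
rewrite tE; apply/andP; split.
  apply: (@lt_le_trans _ _ (i%:R / N%:R)); first by rewrite ltrBlDr ltrDl.
  by rewrite ler_pM2r // invr_gt0.
apply: (@le_lt_trans _ _ (i.+1%:R / N%:R)).
  by rewrite ler_pM2r // invr_gt0.
by rewrite -natr1 mulrDl mul1r ltrD2l.
Qed.

End Lebesgue.

(** * Pasting of continuous maps *)

Section Pasting.
Variable R : realType.

Lemma continuous_pasting (X Y : topologicalType) (a b : X -> R) (f h : X -> Y) :
  continuous a -> continuous b -> continuous f -> continuous h ->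
  (forall x, a x = b x -> f x = h x) ->
  continuous (fun x => if a x <= b x then f x else h x).
Proof.
move=> ca cb cf ch fh x.
have cab : continuous (fun x => b x - a x).
  by move=> y; apply: cvgB; [exact: cb | exact: ca].
have [lt|gt|eq] := ltgtP (a x) (b x).
- have op : nbhs (b x - a x) [set r | 0 < r].
    by apply: open_nbhs_nbhs; split; [exact: open_gt | rewrite /= subr_gt0].
  rewrite /continuous_at ifT ?(ltW lt) //; apply: cvg_trans (cf x).
  have hn : \forall y \near x, 0 < b y - a y := cab x _ op.
  apply: near_eq_cvg; apply: filterS hn => y /=.
  by rewrite subr_gt0 => /ltW ->.
- have op : nbhs (b x - a x) [set r | r < 0].
    by apply: open_nbhs_nbhs; split; [exact: open_lt | rewrite /= subr_lt0].
  rewrite /continuous_at ifF ?(lt_geF gt) //; apply: cvg_trans (ch x).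
  have hn : \forall y \near x, b y - a y < 0 := cab x _ op.
  apply: near_eq_cvg; apply: filterS hn => y /=.
  by rewrite subr_lt0 => /lt_geF ->.
- rewrite /continuous_at eq lexx => V /= hV; have fV := cf x V hV.
  have hV' : nbhs x (h @^-1` V) by apply: ch; rewrite -fh.
  have fV' : nbhs x (f @^-1` V) by exact: fV.
  apply: (filterS _ (filterI fV' hV')) => y [fy hy] /=.
  by case: ifP.
Qed.

(** For [l] nonnegative, the retraction of the line onto the segment from 0 to [l]. Composing with
    it turns continuity on a segment into continuity everywhere, so that paths are pasted without
    subspaces. *)
Definition clamp (l t : R) : R := Num.max 0 (Num.min l t).

Lemma clamp_id l t : 0 <= t <= l -> clamp l t = t.
Proof. by move=> /andP[t0 tl]; rewrite /clamp min_r // max_r. Qed.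

Lemma clamp_in l t : 0 <= l -> 0 <= clamp l t <= l.
Proof. by move=> l0; rewrite /clamp le_max lexx ge_max l0 ge_min lexx. Qed.

Lemma clamp_continuous l : continuous (clamp l).
Proof.
move=> t; apply: (@continuous_max R R (fun=> 0) (Num.min l)).
  exact: cst_continuous.
apply: (@continuous_min R R (fun=> l) id); last exact: cvg_id.
exact: cst_continuous.
Qed.

Lemma within_retract (X S : topologicalType) (A : set X) (r : X -> X)
    (f : X -> S) : (forall x, A (r x)) -> continuous r ->
  {within A, continuous f} -> continuous (f \o r).
Proof.
move=> rA cr /subspace_continuousP cf x V hV.
have hn : nbhs x (r @^-1` (fun u => A u -> V (f u))).
  exact: (cr x _ (cf _ (rA x) V hV)).
by apply: filterS hn => u /=; apply.
Qed.

Lemma within_clamp (S : topologicalType) (f : R -> S) :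
  {within `[0, 1], continuous f} -> continuous (fun t => f (clamp 1 t)).
Proof.
apply: within_retract; last exact: clamp_continuous.
by move=> t; rewrite /= in_itv /= clamp_in.
Qed.

Lemma eq_within_continuous (S : topologicalType) (f h : R -> S) :
  (forall t, 0 <= t <= 1 -> h t = f t) -> continuous h ->
  {within `[0, 1], continuous f}.
Proof.
move=> fh /continuous_subspaceT ch; apply: subspace_eq_continuous (ch _).
by move=> t /=; rewrite inE /= in_itv /=; exact: fh.
Qed.

Lemma loop_concat_is_loop (S : topologicalType) (x0 : S) (f h : R -> S) :
  is_loop x0 f -> is_loop x0 h -> is_loop x0 (loop_concat f h).
Proof.
move=> [cf f0 f1] [ch h0 h1]; split.
- apply: (@eq_within_continuous _ _ (fun t => if t <= 1 / 2
      then f (clamp 1 (2 * t)) else h (clamp 1 (2 * t - 1)))).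
    move=> t t01; rewrite /loop_concat.
    by case: ifP => t2; rewrite clamp_id //; lra.
  have c2 (k : R) : continuous (fun t : R => 2 * t - k).
    move=> t; apply: cvgB; last exact: cvg_cst.
    by apply: cvgM; [exact: cvg_cst | exact: cvg_id].
  apply: (@continuous_pasting _ _ id (fun=> 1 / 2)).
  + by move=> t; exact: cvg_id.
  + exact: cst_continuous.
  + move=> t; apply: (@continuous_comp R R S (fun t => 2 * t)
      (fun t => f (clamp 1 t))).
      by apply: cvgM; [exact: cvg_cst | exact: cvg_id].
    exact: within_clamp.
  + move=> t; apply: (@continuous_comp R R S (fun t => 2 * t - 1)
      (fun t => h (clamp 1 t))).
      exact: c2.
    exact: within_clamp.
  + move=> t /= ->; have -> : 2 * (1 / 2) = 1 :> R by field.
    by rewrite subrr !clamp_id ?lexx ?ler01 // f1 h0.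
- by rewrite /loop_concat mulr0 f0 ifT //; lra.
- rewrite /loop_concat ifF; last by apply/negbTE; rewrite -ltNge; lra.
  by rewrite -h1; congr h; ring.
Qed.

End Pasting.

Section Transport.
Variables (R : realType) (S : topologicalType) (G : groupType).
Variable c : S -> S -> G.

(* A locally multiplicative function is a locally constant system of
   coefficients, given by its parallel transport between nearby points. *)
Definition locally_multiplicative : Prop :=
  forall s : S, exists2 U, nbhs s U &
    forall p q r, U p -> U q -> U r -> (c p q * c q r)%g = c p r.

Hypothesis hc : locally_multiplicative.

Lemma transport_refl p : c p p = 1%g.
Proof.
have [U /nbhs_singleton Up /(_ p p p Up Up Up) h] := hc p.
by apply: (mulgI (c p p)); rewrite h mulg1.
Qed.

(* [C] is the parallel transport along the path [f]. *)
Definition is_lift (f : R -> S) (C : R -> G) (N : nat) : Prop :=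
  (0 < N)%N /\ forall i p q, (i < N)%N -> cell N i p -> cell N i q ->
    ((C p)^-1 * C q)%g = c (f p) (f q).

Definition transport (f : R -> S) N : G :=
  (\prod_(i < N) c (f (i%:R / N%:R)%R) (f (i.+1%:R / N%:R)%R))%g.

Lemma lift_refine f C N M : (0 < M)%N -> is_lift f C N -> is_lift f C (N * M).
Proof.
move=> M0 [N0 h]; split; first by rewrite muln_gt0 N0.
move=> i p q iNM cp cq; apply: (h (i %/ M)%N); last exact: cell_refine.
  by rewrite ltn_divLR.
exact: cell_refine.
Qed.

Lemma lift_transport f C N : is_lift f C N ->
  transport f N = ((C 0%R)^-1 * C 1%R)%g.
Proof.
move=> [N0 h]; rewrite /transport.
have key n : (n <= N)%N ->
    (\prod_(i < n) c (f (i%:R / N%:R)%R) (f (i.+1%:R / N%:R)%R))%g =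
    ((C 0%R)^-1 * C (n%:R / N%:R)%R)%g.
  elim: n => [|n IH] nN; first by rewrite big_ord0 mul0r mulVg.
  rewrite big_ord_recr /= IH ?(ltnW nN) //.
  rewrite -(h n) ?cell_left ?cell_right // mulgA.
  by rewrite -(mulgA _ (C _)) mulgV mulg1.
by rewrite key // divff // pnatr_eq0 -lt0n.
Qed.

(** On a common refinement both sides are the same product. *)
Lemma lift_unique f C N C' N' : is_lift f C N -> is_lift f C' N' ->
  ((C 0%R)^-1 * C 1%R)%g = ((C' 0%R)^-1 * C' 1%R)%g.
Proof.
move=> h h'; rewrite -(lift_transport (lift_refine h'.1 h)).
by rewrite mulnC (lift_transport (lift_refine h.1 h')).
Qed.

Definition fine (f : R -> S) N : Prop :=
  (0 < N)%N /\ forall i p q r, (i < N)%N ->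
    cell N i p -> cell N i q -> cell N i r ->
    (c (f p) (f q) * c (f q) (f r))%g = c (f p) (f r).

(** The product over the previous cells is completed by one factor inside the cell. The right end of
    a cell is assigned to the next one by truncation; multiplicativity on the cell makes both
    formulas agree there. *)
Lemma lift_exists f N : fine f N -> exists C, is_lift f C N.
Proof.
move=> [N0 h].
pose T n := (\prod_(i < n) c (f (i%:R / N%:R)%R) (f (i.+1%:R / N%:R)%R))%g.
pose k (t : R) := Num.truncn (t * N%:R)%R.
pose C t := (T (k t) * c (f ((k t)%:R / N%:R)%R) (f t))%g.
have N0' : 0 < N%:R :> R by rewrite ltr0n.
have CE i t : (i < N)%N -> cell N i t ->
    C t = (T i * c (f (i%:R / N%:R)%R) (f t))%g.
  move=> iN ct; have := ct => /andP[h1 h2].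
  have tN0 : 0 <= t * N%:R by rewrite (le_trans _ h1).
  have := truncn_itv tN0; rewrite -/(k t) => /andP[k1 k2].
  have ik : (i <= k t)%N.
    by rewrite -ltnS -(ltr_nat R) (le_lt_trans h1).
  have ki : (k t <= i.+1)%N by rewrite -(ler_nat R) (le_trans k1).
  move: ik; rewrite leq_eqVlt => /orP[/eqP ik|ik].
    by rewrite /C -ik.
  have kE : k t = i.+1 by apply/eqP; rewrite eqn_leq ki.
  by rewrite /C kE /T big_ord_recr /= -mulgA (h i) ?cell_left ?cell_right.
exists C; split => // i p q iN cp cq.
rewrite !(CE i) // invgM -mulgA (mulgA _ (T i)) mulVg mul1g.
apply: (mulgI (c (f (i%:R / N%:R)%R) (f p))).
by rewrite mulgA mulgV mul1g (h i) // cell_left.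
Qed.

Lemma local_triple (X : pseudoMetricType R) (K : set X) (f : X -> S) z :
  {within K, continuous f} -> K z ->
  exists2 e : R, 0 < e & forall z1 z2 z3, K z1 -> K z2 -> K z3 ->
    ball z e z1 -> ball z e z2 -> ball z e z3 ->
    (c (f z1) (f z2) * c (f z2) (f z3))%g = c (f z1) (f z3).
Proof.
move=> /subspace_continuousP cf Kz; have [U Uz hU] := hc (f z).
have /nbhs_ballP[e e0 he] := cf z Kz _ Uz.
by exists e => // z1 z2 z3 K1 K2 K3 b1 b2 b3; apply: hU; exact: he.
Qed.

Lemma fine_exists (f : R -> S) :
  {within `[0, 1], continuous f} -> exists N, fine f N.
Proof.
move=> cf; have [e e0 he] := @lebesgue_triple R R `[0, 1]%classic
  (fun p q r => (c (f p) (f q) * c (f q) (f r))%g = c (f p) (f r))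
  (@segment_compact R 0 1) (fun z => @local_triple R _ f z cf).
have [N N0 hN] := cell_ball e0; exists N; split => // i p q r iN cp cq cr.
by apply: (he (i%:R / N%:R)); rewrite /= ?in_itv /= ?(cell01 iN) //
  ?cell_left //; exact: hN.
Qed.

Lemma local_lift f C :
  (forall t : R, 0 <= t <= 1 -> exists2 e : R, 0 < e & forall p q : R,
     0 <= p <= 1 -> 0 <= q <= 1 -> `|p - t| < e -> `|q - t| < e ->
     ((C p)^-1 * C q)%g = c (f p) (f q)) ->
  exists N, is_lift f C N.
Proof.
move=> loc.
have loc' (z : R) : `[0, 1]%classic z ->
    exists2 e : R, 0 < e & forall p q r : R,
    `[0, 1]%classic p -> `[0, 1]%classic q -> `[0, 1]%classic r ->
    ball z e p -> ball z e q -> ball z e r ->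
    ((C p)^-1 * C q)%g = c (f p) (f q).
  rewrite /= in_itv /= => /loc[e e0 he]; exists e => // p q r.
  rewrite /= !in_itv /= => p01 q01 _ bp bq _.
  by apply: he => //; rewrite distrC.
have [e e0 he] := lebesgue_triple (@segment_compact R 0 1) loc'.
have [N N0 hN] := cell_ball e0; exists N; split => // i p q iN cp cq.
by apply: (he (i%:R / N%:R) p q q); rewrite /= ?in_itv /= ?(cell01 iN) //
  ?cell_left //; exact: hN.
Qed.

(** The lift of [h] is multiplied on the left by [C 1 * (D 0)^-1], to agree with [C] at the
    junction; a common mesh [K] becomes [2 * K] for the concatenation. *)
Lemma lift_concat f h C D N N' : f 1 = h 0 -> is_lift f C N -> is_lift h D N' ->
  exists E M, is_lift (loop_concat f h) E M /\
    ((E 0%R)^-1 * E 1%R =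
      (C 0%R)^-1 * C 1%R * ((D 0%R)^-1 * D 1%R))%g.
Proof.
move=> fh hf hh; have {hf hh} [[K0 hf] [_ hh]] :
    is_lift f C (N * N') /\ is_lift h D (N * N').
  split; first exact: lift_refine hh.1 hf.
  by rewrite mulnC; exact: lift_refine hf.1 hh.
move: (N * N')%N => K in K0 hf hh *.
pose E (t : R) := if (t <= 1 / 2)%R then C (2 * t)%R
  else (C 1%R * (D 0%R)^-1 * D (2 * t - 1)%R)%g.
exists E, (2 * K)%N; split; last first.
  have -> : E 0 = C 0 by rewrite /E mulr0 ifT //; lra.
  have -> : E 1 = (C 1%R * (D 0%R)^-1 * D 1%R)%g.
    rewrite /E ifF; last by apply/negbTE; rewrite -ltNge; lra.
    by have -> : 2 * 1 - 1 = 1 :> R by ring.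
  by rewrite !mulgA.
split; first by rewrite muln_gt0.
have K0' : 0 < K%:R :> R by rewrite ltr0n.
have first_half i t : (i < K)%N -> cell (2 * K) i t ->
    [/\ cell K i (2 * t), E t = C (2 * t)%R & loop_concat f h t = f (2 * t)%R].
  move=> iK; rewrite /cell natrM mulrA (mulrC t) => ct.
  have t2 : t <= 1 / 2.
    have /andP[_ h2] := ct; have : 2 * t * K%:R <= K%:R.
      by rewrite (le_trans h2) // ler_nat.
    by rewrite -ler_pdivlMr // divff ?gt_eqF //; lra.
  by rewrite /E /loop_concat t2.
have second_half i t : (K <= i)%N -> cell (2 * K) i t ->
    [/\ cell K (i - K) (2 * t - 1),
        E t = (C 1%R * (D 0%R)^-1 * D (2 * t - 1)%R)%g
      & loop_concat f h t = h (2 * t - 1)%R].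
  move=> iK; rewrite /cell natrM mulrA (mulrC t) => ct.
  have t2 : 1 / 2 <= t.
    have /andP[h2 _] := ct; have : K%:R <= 2 * t * K%:R.
      by rewrite (le_trans _ h2) // ler_nat.
    by rewrite -ler_pdivrMr // divff ?gt_eqF //; lra.
  split.
  - rewrite -subSn // !natrB ?(leq_trans iK) //.
    by move: ct => /andP[h1 h2]; apply/andP; split; lra.
  - rewrite /E; case: ifP => // t3.
    have -> : t = 1 / 2 by apply/eqP; rewrite eq_le t3.
    have -> : 2 * (1 / 2) = 1 :> R by field.
    by rewrite subrr mulgVK.
  - rewrite /loop_concat; case: ifP => // t3.
    have -> : t = 1 / 2 by apply/eqP; rewrite eq_le t3.
    have -> : 2 * (1 / 2) = 1 :> R by field.
    by rewrite subrr.
move=> i p q i2K cp cq; case: (ltnP i K) => iK.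
  have [cp' -> ->] := first_half _ _ iK cp.
  have [cq' -> ->] := first_half _ _ iK cq.
  exact: hf cp' cq'.
have [cp' -> ->] := second_half _ _ iK cp.
have [cq' -> ->] := second_half _ _ iK cq.
have iK2 : (i - K < K)%N by lia.
by rewrite -(hh _ _ _ iK2 cp' cq') invgM -[LHS]mulgA mulKg.
Qed.

(** Cut the square into cells on which [c] is multiplicative. Sweeping over a strip of cells
    compares the transports along its two long sides; its two ends are constant paths and contribute
    nothing. *)
Lemma homotopy_transport (H : R * R -> S) (x0 x1 : S) :
  {within `[0, 1] `*` `[0, 1], continuous H} ->
  (forall s, 0 <= s <= 1 -> H (s, 0) = x0 /\ H (s, 1) = x1) ->
  exists N, [/\ fine (fun t => H (0, t)) N, fine (fun t => H (1, t)) N &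
    transport (fun t => H (0, t)) N = transport (fun t => H (1, t)) N].
Proof.
move=> cH ends.
have [e e0 he] := @lebesgue_triple R (R * R)%type (`[0, 1] `*` `[0, 1])%classic
  (fun p q r => (c (H p) (H q) * c (H q) (H r))%g = c (H p) (H r))
  (compact_setX (@segment_compact R 0 1) (@segment_compact R 0 1))
  (fun z => @local_triple _ _ H z cH).
have [N N0 hN] := cell_ball e0; exists N.
have N0' : 0 < N%:R :> R by rewrite ltr0n.
have key i j (p q r : R * R) : (i < N)%N -> (j < N)%N ->
    cell N i p.1 -> cell N j p.2 -> cell N i q.1 -> cell N j q.2 ->
    cell N i r.1 -> cell N j r.2 ->
    (c (H p) (H q) * c (H q) (H r))%g = c (H p) (H r).
  move=> iN jN p1 p2 q1 q2 r1 r2.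
  have inK (x : R * R) : cell N i x.1 -> cell N j x.2 ->
      (`[0, 1] `*` `[0, 1])%classic x.
    move=> h1 h2; split; rewrite /= in_itv /=; first exact: cell01 iN h1.
    exact: cell01 jN h2.
  have inB (x : R * R) : cell N i x.1 -> cell N j x.2 ->
      ball ((i%:R / N%:R, j%:R / N%:R) : R * R) e x.
    by move=> h1 h2; split; exact: hN.
  by apply: (he (i%:R / N%:R, j%:R / N%:R)); [apply: inK; rewrite ?cell_left
    | exact: inK | exact: inK | exact: inK
    | exact: inB | exact: inB | exact: inB].
have c0 : cell N 0 (0 : R) by have := @cell_left R _ 0 N0; rewrite mul0r.
have c1 : cell N N.-1 (1 : R).
  by have := @cell_right R _ N.-1 N0; rewrite prednK // divff // gt_eqF.
have row i s : (i < N)%N -> cell N i s -> fine (fun t => H (s, t)) N.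
  by move=> iN cs; split => // k p q r kN cp cq cr; exact: (key i k).
have step i : (i < N)%N ->
    transport (fun t => H (i%:R / N%:R, t)) N =
    transport (fun t => H (i.+1%:R / N%:R, t)) N.
  move=> iN; rewrite /transport.
  pose h k j := H (k%:R / N%:R, j%:R / N%:R).
  have cut n : (n <= N)%N ->
      ((\prod_(j < n) c (h i j) (h i j.+1)) * c (h i n) (h i.+1 n) =
       c (h i 0) (h i.+1 0) * \prod_(j < n) c (h i.+1 j) (h i.+1 j.+1))%g.
    elim: n => [|n IH] nN; first by rewrite !big_ord0 mul1g mulg1.
    rewrite !big_ord_recr /= mulgA -IH ?(ltnW nN) // -!mulgA; congr (_ * _)%g.
    by rewrite !(key i n) //= ?cell_left ?cell_right.
  have si : 0 <= (i%:R / N%:R : R) <= 1 by apply: (cell01 iN); exact: cell_left.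
  have si1 : 0 <= (i.+1%:R / N%:R : R) <= 1.
    by apply: (cell01 iN); exact: cell_right.
  have NN : N%:R / N%:R = 1 :> R by rewrite divff // gt_eqF.
  have := cut N (leqnn N); rewrite /h NN mul0r.
  rewrite (ends _ si).1 (ends _ si).2 (ends _ si1).1 (ends _ si1).2.
  by rewrite !transport_refl mulg1 mul1g.
have steps n : (n <= N)%N -> transport (fun t => H (0, t)) N =
    transport (fun t => H (n%:R / N%:R, t)) N.
  by elim: n => [|n IH] nN; rewrite ?mul0r // IH 1?step // ltnW.
split; [exact: row c0|apply: row c1; lia|].
by rewrite (steps N) // divff // gt_eqF.
Qed.

(** The holonomy of the local system. It is stated through lifts rather than through [transport],
    because lifts are what is computed explicitly for rays. *)
Lemma transport_hom (x0 : S) (Gamma : groupType) (cls : (R -> S) -> Gamma) :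
  (forall x, exists2 f, is_loop x0 f & cls f = x) ->
  (forall f h, is_loop x0 f -> is_loop x0 h ->
     cls f = cls h <-> loop_homotopic x0 f h) ->
  (forall f h, is_loop x0 f -> is_loop x0 h ->
     cls (loop_concat f h) = (cls f * cls h)%g) ->
  exists psi : Gamma -> G, (forall x y, psi (x * y)%g = (psi x * psi y)%g) /\
    forall f C N, is_loop x0 f -> is_lift f C N ->
      psi (cls f) = ((C 0%R)^-1 * C 1%R)%g.
Proof.
move=> cls_surj cls_eq cls_mul.
have lift f : is_loop x0 f -> exists C N, is_lift f C N.
  by case=> /fine_exists[N /lift_exists[C hC]] _ _; exists C, N.
have hom_eq f h C D N M : is_loop x0 f -> is_loop x0 h -> cls f = cls h ->
    is_lift f C N -> is_lift h D M ->
    ((C 0%R)^-1 * C 1%R = (D 0%R)^-1 * D 1%R)%g.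
  move=> lf lh /(cls_eq _ _ lf lh)[H [cH H0 H1 Hends]] hC hD.
  have [K [fK hK tK]] := homotopy_transport cH Hends.
  have [C' hC'] := lift_exists fK; have [D' hD'] := lift_exists hK.
  have K0 := fK.1.
  have hfC : is_lift f C' K.
    split => // i p q iK cp cq; rewrite (hC'.2 i) //.
    by rewrite !H0 // (cell01 iK).
  have hhD : is_lift h D' K.
    split => // i p q iK cp cq; rewrite (hD'.2 i) //.
    by rewrite !H1 // (cell01 iK).
  rewrite (lift_unique hC hfC) (lift_unique hD hhD).
  by rewrite -(lift_transport hC') -(lift_transport hD').
have [psi psiP] : {psi : Gamma -> G & forall x, forall f C N, is_loop x0 f ->
    cls f = x -> is_lift f C N -> psi x = ((C 0%R)^-1 * C 1%R)%g}.
  apply: (@choice Gamma G (fun x y => forall f C N, is_loop x0 f ->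
    cls f = x -> is_lift f C N -> y = ((C 0%R)^-1 * C 1%R)%g)) => x.
  have [f lf fx] := cls_surj x; have [C [N hC]] := lift f lf.
  exists ((C 0%R)^-1 * C 1%R)%g => h D M lh hx hD.
  by apply: hom_eq hC hD => //; rewrite fx hx.
exists psi; split => [x y|f C N lf hC]; last exact: psiP lf erefl hC.
have [f lf fx] := cls_surj x; have [h lh hy] := cls_surj y.
have [C [N hC]] := lift f lf; have [D [M hD]] := lift h lh.
have fh1 : f 1 = h 0 by case: lf => _ _ ->; case: lh.
have [E [K [hE EE]]] := lift_concat fh1 hC hD.
rewrite (psiP x f C N) // (psiP y h D M) // -EE.
rewrite -(psiP (x * y)%g (loop_concat f h) E K) //.
  exact: loop_concat_is_loop.
by rewrite cls_mul // fx hy.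
Qed.

End Transport.

(** * Crossing closed curves on the surface *)

Section CircleCoordinates.
Variable R : realType.
Implicit Types (t u : R) (z : R * R).

Definition trapezoid (j : nat) t : R :=
  clamp 1 (Num.min (t - j%:R) (j%:R + 3 - t)).

Lemma trapezoid_in j t : 0 <= trapezoid j t <= 1.
Proof. exact: clamp_in. Qed.

Lemma trapezoid_l j t : t <= j%:R -> trapezoid j t = 0.
Proof.
move=> ?; rewrite /trapezoid /clamp; case: (leP (t - _)) => ?;
  by case: (leP 1) => ?; case: (leP 0) => ?; lra.
Qed.

Lemma trapezoid_r j t : j%:R + 3 <= t -> trapezoid j t = 0.
Proof.
move=> ?; rewrite /trapezoid /clamp; case: (leP (t - _)) => ?;
  by case: (leP 1) => ?; case: (leP 0) => ?; lra.
Qed.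

Lemma trapezoid_up j t : j%:R <= t <= j%:R + 1 -> trapezoid j t = t - j%:R.
Proof.
move=> ?; rewrite /trapezoid /clamp; case: (leP (t - _)) => ?;
  by case: (leP 1) => ?; case: (leP 0) => ?; lra.
Qed.

Lemma trapezoid_mid j t : j%:R + 1 <= t <= j%:R + 2 -> trapezoid j t = 1.
Proof.
move=> ?; rewrite /trapezoid /clamp; case: (leP (t - _)) => ?;
  by case: (leP 1) => ?; case: (leP 0) => ?; lra.
Qed.

Lemma trapezoid_down j t :
  j%:R + 2 <= t <= j%:R + 3 -> trapezoid j t = j%:R + 3 - t.
Proof.
move=> ?; rewrite /trapezoid /clamp; case: (leP (t - _)) => ?;
  by case: (leP 1) => ?; case: (leP 0) => ?; lra.
Qed.

(* Modulo 1 this is a map from the surface to the circle: it is dual to the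
   closed curve through the midpoints of the two sides j and j + 2. *)
Definition ucoord j z : R := z.1 * trapezoid j z.2.

(** The circle as the interval from 0 to 1 with 1 sent to 0. The jump at 1 is why only levels
    strictly between 0 and 1 are used to define open sets. *)
Definition circle_coord u : R := if u == 1 then 0 else u.

(** The profile rises on side [j], stays at 1 on the next and falls on side [j + 2]. Sides [j] and
    [j + 2] are glued with reversal, so they agree; the other glued pair of the handle sits at
    levels 0 and 1, equal on the circle; other handles sit at 0. The flag [b] selects which of the
    two pairs is crossed. *)
Lemma ucoord_glue g k (b : bool) z z' : (k < g)%N -> polygon_glue g z z' ->
  circle_coord (ucoord (4 * k + b) z) = circle_coord (ucoord (4 * k + b) z').
Proof.
move=> kg; set j := (4 * k + b)%N.
have jE : j%:R = 4 * k%:R + b%:R :> R by rewrite /j natrD natrM.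
have b01 : 0 <= (b%:R : R) <= 1 by case: (b) => /=; lra.
have kR0 : 0 <= k%:R :> R by exact: ler0n.
have cmp k' : (k' = k) \/ (k'%:R + 1 <= k%:R :> R \/ k%:R + 1 <= k'%:R :> R).
  have [lt|gt|->] := ltngtP k' k; [right; left|right; right|by left].
    by rewrite natr1 ler_nat.
  by rewrite natr1 ler_nat.
have c1 : circle_coord 1 = 0 :> R by rewrite /circle_coord eqxx.
have c0 : circle_coord 0 = 0 :> R by rewrite /circle_coord; case: ifP.
elim=> {z z'} [t t' _ _|r _|k' s k'g s01|k' s k'g s01|//|z z' _ -> //|
    z z' z'' _ -> _ ->//]; rewrite /ucoord /= ?mul0r // ?mul1r.
- have kgR : k%:R + 1 <= g%:R :> R by rewrite natr1 ler_nat.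
  rewrite trapezoid_l; last by lra.
  by rewrite trapezoid_r ?mulr0 // natrM; lra.
- rewrite natrD natrM.
  case: (cmp k') => [->|[lt|gt]].
  + case: (b) jE b01 => /= jE _.
      rewrite trapezoid_l; last by lra.
      rewrite trapezoid_mid; last by lra.
      by rewrite c0 c1.
    rewrite trapezoid_up; last by lra.
    rewrite trapezoid_down; last by lra.
    by congr circle_coord; lra.
  + by rewrite !trapezoid_l //; lra.
  + by rewrite !trapezoid_r //; lra.
- rewrite (natrD _ (4 * k') 1) (natrD _ (4 * k') 4) natrM.
  case: (cmp k') => [->|[lt|gt]].
  + case: (b) jE b01 => /= jE _.
      rewrite trapezoid_up; last by lra.
      rewrite trapezoid_down; last by lra.
      by congr circle_coord; lra.
    rewrite trapezoid_mid; last by lra.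
    rewrite trapezoid_r; last by lra.
    by rewrite c0 c1.
  + by rewrite !trapezoid_l //; lra.
  + by rewrite !trapezoid_r //; lra.
Qed.

Lemma ucoord_in j z : 0 <= z.1 <= 1 -> 0 <= ucoord j z <= 1.
Proof.
move=> z01; have t01 := trapezoid_in j z.2; rewrite /ucoord.
by apply/andP; split; nra.
Qed.

Lemma ucoord_disjoint j j' z : (j + 3 <= j')%N -> ucoord j z * ucoord j' z = 0.
Proof.
move=> jj'; rewrite /ucoord.
have jR : j%:R + 3 <= j'%:R :> R by rewrite -natrD ler_nat.
have [h|h] := lerP z.2 j'%:R.
  by rewrite (trapezoid_l h) !mulr0.
by rewrite trapezoid_r ?mulr0 ?mul0r //; lra.
Qed.

Lemma trapezoid_continuous j : continuous (trapezoid j).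
Proof.
move=> t; apply: (@continuous_comp R R R
  (fun t => Num.min (t - j%:R) (j%:R + 3 - t)) (clamp 1)).
  apply: (@continuous_min R R (fun t => t - j%:R) (fun t => j%:R + 3 - t)).
    by apply: cvgB; [exact: cvg_id | exact: cvg_cst].
  by apply: cvgB; [exact: cvg_cst | exact: cvg_id].
exact: clamp_continuous.
Qed.

Lemma ucoord_continuous j : continuous (ucoord j).
Proof.
move=> z; apply: cvgM; first exact: cvg_fst.
apply: (@continuous_comp (R * R)%type R R snd (trapezoid j)).
  exact: cvg_snd.
exact: trapezoid_continuous.
Qed.

Lemma circle_coord_id u : u != 1 -> circle_coord u = u.
Proof. by rewrite /circle_coord => /negbTE ->. Qed.

End CircleCoordinates.

(** * The crossing cocycle *)

Section SurfaceCocycle.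
Variables (R : realType) (S : topologicalType) (g : nat) (q : R * R -> S).
Hypothesis hS : hausdorff_space S.
Hypothesis qcont : {within @polar_disc R g, continuous q}.
Hypothesis qsurj : q @` @polar_disc R g = [set: S].
Hypothesis qglue : forall z z', @polar_disc R g z -> @polar_disc R g z' ->
  q z = q z' <-> polygon_glue g z z'.

Lemma polar_disc_compact : compact (@polar_disc R g).
Proof.
have -> : @polar_disc R g = (`[0, 1] `*` `[0, (4 * g)%:R])%classic.
  by apply/seteqP; split=> z /=; rewrite !in_itv.
by apply: compact_setX; exact: segment_compact.
Qed.

Lemma image_closed (D : set (R * R)) : closed D ->
  closed (q @` (@polar_disc R g `&` D)).
Proof.
move=> cD; apply: compact_closed => //; apply: continuous_compact.
  by apply: continuous_subspaceW qcont => z [].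
by apply: compact_closedI => //; exact: polar_disc_compact.
Qed.

Lemma exists_polar s : exists z, @polar_disc R g z /\ q z = s.
Proof.
have : [set: S] s by [].
by rewrite -qsurj => -[z zd zs]; exists z.
Qed.

(** The preimage in the disc is arbitrary; [ucoord_glue] makes the value independent of it for the
    indices [4 * k + b] with [k < g]. *)
Definition theta j s : R :=
  circle_coord (ucoord j (sval (cid (exists_polar s)))).

Lemma thetaE k (b : bool) z : (k < g)%N -> @polar_disc R g z ->
  theta (4 * k + b) (q z) = circle_coord (ucoord (4 * k + b) z).
Proof.
move=> kg dz; rewrite /theta; case: cid => z' /= [dz' zz'].
exact: ucoord_glue kg ((qglue dz' dz).1 zz').
Qed.

Lemma theta_disjoint j j' s : (j + 3 <= j')%N ->
  theta j s = 0 \/ theta j' s = 0.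
Proof.
move=> jj'; rewrite /theta; case: cid => z _ /=.
have /eqP := ucoord_disjoint z jj'; rewrite mulf_eq0.
by case/orP => /eqP ->; [left|right]; rewrite /circle_coord;
  case: eqP.
Qed.

(** The complement is the image of a compact set, hence closed. The bounds [0 < l] and [r < 1] avoid
    the jump of [circle_coord]: points with coordinate 1 have [theta] equal to 0 and belong to the
    complement. *)
Lemma open_theta_between k (b : bool) (l r : R) :
  (k < g)%N -> 0 < l -> l <= r -> r < 1 ->
  open [set s | l < theta (4 * k + b) s < r].
Proof.
move=> kg l0 lr r1; set j := (4 * k + b)%N.
have -> : [set s | l < theta j s < r] =
    ~` (q @` (@polar_disc R g `&` (ucoord j @^-1` [set u | u <= l] `|`
                                ucoord j @^-1` [set u | r <= u]))).
  apply/seteqP; split=> s /=.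
    move=> hs [z [dz hz] zs]; move: hs; rewrite -zs thetaE // -/j.
    rewrite /circle_coord; case: eqP => [_|_] /andP[h1 h2]; first lra.
    by case: hz => /= hz; lra.
  move=> h; have [z [dz zs]] := exists_polar s.
  apply/andP; split; rewrite ltNge; apply/negP => hh; apply: h;
    exists z => //; split=> //=; move: hh;
    rewrite -zs thetaE // -/j /circle_coord.
    by case: eqP => [->|_] hh; [right; exact: ltW|left].
  by case: eqP => [_|_] hh; [exfalso; lra | right].
apply: closed_openC; apply: image_closed; apply: closedU.
  by apply: preimage_closed;
    [move=> z _; exact: ucoord_continuous | exact: closed_le].
by apply: preimage_closed;
    [move=> z _; exact: ucoord_continuous | exact: closed_ge].
Qed.

Lemma open_theta_outside k (b : bool) (l r : R) : (k < g)%N -> 0 < l -> r < 1 ->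
  open [set s | ~~ (l <= theta (4 * k + b) s <= r)].
Proof.
move=> kg l0 r1; set j := (4 * k + b)%N.
have -> : [set s | ~~ (l <= theta j s <= r)] =
    ~` (q @` (@polar_disc R g `&`
      ucoord j @^-1` ([set u | l <= u] `&` [set u | u <= r]))).
  apply/seteqP; split=> s /=.
    move=> /negP hs [z [dz [/= h1 h2]] zs]; apply: hs.
    rewrite -zs thetaE // -/j.
    by rewrite circle_coord_id ?h1 ?h2 //; apply/eqP; lra.
  move=> h; have [z [dz zs]] := exists_polar s.
  apply/negP; rewrite -zs thetaE // -/j /circle_coord.
  case: eqP => [_|_] /andP[h1 h2]; first lra.
  by apply: h; exists z.
apply: closed_openC; apply: image_closed.
apply: preimage_closed; first by move=> z _; exact: ucoord_continuous.
by apply: closedI; [exact: closed_ge | exact: closed_le].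
Qed.

Variables (G : groupType) (x y : G) (k k' : nat) (b : bool).
Hypothesis (kk' : (k < k')%N) (k'g : (k' < g)%N).

Local Notation j := (4 * k + b)%N.
Local Notation j' := (4 * k' + b)%N.

(** Level 1/2 is the curve. In every use one of [u], [u'] is 0, so the order of the tests is
    immaterial. *)
Definition mark (u u' : R) : G :=
  if 1 / 2 <= u then x else if 1 / 2 <= u' then y else 1%g.

Let C s := mark (theta j s) (theta j' s).
Let kg : (k < g)%N. Proof. exact: ltn_trans kk' k'g. Qed.
Let jj' : (j + 3 <= j')%N. Proof. by lia. Qed.

(** A coboundary between points with close coordinates and trivial otherwise, so that passing level
    1/2 counts while the jump from 1 to 0 does not. *)
Definition crossing s s' : G :=
  if (`|theta j s - theta j s'| < 1 / 8) &&
     (`|theta j' s - theta j' s'| < 1 / 8)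
  then ((C s)^-1 * C s')%g else 1%g.

(** Near level 1/2 of one curve the other coordinate is 0, and a neighbourhood of radius 1/16 keeps
    differences below 1/8, so the cocycle is a coboundary. Away from both levels it is trivial: the
    band from 7/16 to 9/16 has width 1/8, so two points outside it with coordinates less than 1/8
    apart lie on the same side. *)
Lemma crossing_locally_multiplicative : locally_multiplicative crossing.
Proof.
move=> s.
have mult (U : set S) : (forall p r, U p -> U r ->
    `|theta j p - theta j r| < 1 / 8 /\
    `|theta j' p - theta j' r| < 1 / 8) -> forall p r o, U p -> U r -> U o ->
    (crossing p r * crossing r o)%g = crossing p o.
  move=> h p r o Up Ur Uo; rewrite /crossing.
  rewrite !(h p r Up Ur).1 !(h p r Up Ur).2 !(h r o Ur Uo).1 !(h r o Ur Uo).2.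
  rewrite !(h p o Up Uo).1 !(h p o Up Uo).2 /=.
  by rewrite mulgA -(mulgA _ (C r)) mulgV mulg1.
pose near a : set S :=
  [set p | theta a s - 1 / 16 < theta a p < theta a s + 1 / 16].
have nb a : open (near a) -> nbhs s (near a).
  by move=> oU; apply: open_nbhs_nbhs; split; rewrite // /near /=; lra.
have [h1|h1] := boolP (7 / 16 <= theta j s <= 9 / 16).
  exists (near j).
    by apply: nb; apply: open_theta_between => //; lra.
  apply: mult => p r; rewrite /near /= => Up Ur.
  split; first by rewrite ltr_norml; lra.
  have [e|->] := theta_disjoint p jj'; first lra.
  have [e|->] := theta_disjoint r jj'; first lra.
  by rewrite subrr normr0; lra.
have [h2|h2] := boolP (7 / 16 <= theta j' s <= 9 / 16).
  exists (near j').
    by apply: nb; apply: open_theta_between => //; lra.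
  apply: mult => p r; rewrite /near /= => Up Ur.
  split; last by rewrite ltr_norml; lra.
  have [->|e] := theta_disjoint p jj'; last lra.
  have [->|e] := theta_disjoint r jj'; last lra.
  by rewrite subrr normr0; lra.
pose U a : set S := [set p | ~~ (7 / 16 <= theta a p <= 9 / 16)].
exists (U j `&` U j').
  apply: filterI; apply: open_nbhs_nbhs; split => //;
    by apply: open_theta_outside => //; lra.
have same a p r : U a p -> U a r -> `|theta a p - theta a r| < 1 / 8 ->
    (1 / 2 <= theta a p) = (1 / 2 <= theta a r).
  rewrite /U /= !negb_and -!ltNge ltr_norml => hp hr h.
  by apply/idP/idP; lra.
have triv p r : (U j `&` U j') p -> (U j `&` U j') r -> crossing p r = 1%g.
  move=> [p1 p2] [r1 r2]; rewrite /crossing; case: ifP => // /andP[d1 d2].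
  by rewrite /C /mark (same _ _ _ p1 r1 d1) (same _ _ _ p2 r2 d2) mulVg.
by move=> p r o Up Ur Uo; rewrite !triv // mulg1.
Qed.

(* The jump of a coordinate from 1 to 0 is not a crossing of the curve. *)
Let mark_circle_coord (u u' w w' : R) :
  0 <= u <= 1 -> 0 <= u' <= 1 -> u = 0 \/ u' = 0 ->
  0 <= w <= 1 -> 0 <= w' <= 1 -> w = 0 \/ w' = 0 ->
  `|u - w| < 1 / 8 -> `|u' - w'| < 1 / 8 ->
  ((mark u u')^-1 * mark w w')%g =
  if (`|circle_coord u - circle_coord w| < 1 / 8) &&
     (`|circle_coord u' - circle_coord w'| < 1 / 8)
  then ((mark (circle_coord u) (circle_coord u'))^-1 *
        mark (circle_coord w) (circle_coord w'))%g else 1%g.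
Proof.
move=> u01 u'01 uu' w01 w'01 ww' d d'.
have [/andP[/andP[u1 u'1] /andP[w1 w'1]]|] :=
    boolP (((u != 1) && (u' != 1)) && ((w != 1) && (w' != 1))).
  by rewrite !circle_coord_id // d d'.
have zero (a a' : R) : a = 0 \/ a' = 0 -> a = 1 \/ a' = 1 ->
    circle_coord a = 0 /\ circle_coord a' = 0.
  have c1 : circle_coord 1 = 0 :> R by rewrite /circle_coord eqxx.
  have c0 : circle_coord 0 = 0 :> R by rewrite /circle_coord; case: ifP.
  by case=> ->; case=> e; rewrite ?e ?c0 ?c1 //; split=> //; move/eqP: e;
    rewrite eq_sym oner_eq0.
move: d d'; rewrite !ltr_norml !negb_and !negbK => d d' some1.
have -> : mark u u' = mark w w'.
  rewrite /mark; have -> : (1 / 2 <= u) = (1 / 2 <= w).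
    apply/idP/idP; case: uu' ww' => [] ? [] ?;
      by case/orP: some1 => /orP[] /eqP ?; lra.
  have -> // : (1 / 2 <= u') = (1 / 2 <= w').
  apply/idP/idP; case: uu' ww' => [] ? [] ?;
    by case/orP: some1 => /orP[] /eqP ?; lra.
rewrite mulVg; case: ifP => // /andP[/andP[h1 h2] /andP[h3 h4]].
have mark1 (a a' : R) : a < 1 / 2 -> a' < 1 / 2 -> mark a a' = 1%g.
  by move=> ha ha'; rewrite /mark leNgt ha leNgt ha'.
have [] : (u = 1 \/ u' = 1) \/ (w = 1 \/ w' = 1).
  by case/orP: some1 => /orP[] /eqP; tauto.
  move=> /(zero _ _ uu')[e e']; rewrite e e' in h1 h2 h3 h4 *.
  by rewrite !mark1 ?mulVg //; lra.
move=> /(zero _ _ ww')[e e']; rewrite e e' in h1 h2 h3 h4 *.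
by rewrite !mark1 ?mulVg //; lra.
Qed.

(** On a path drawn in the disc the coordinates before reduction modulo 1 are continuous, so [mark]
    of them is a lift along the whole path. No continuity is asked of [z], whose angle jumps at the
    centre. *)
Lemma crossing_lift (f : R -> S) (u u' : R -> R) :
  continuous u -> continuous u' ->
  (forall t, 0 <= t <= 1 -> exists z, [/\ @polar_disc R g z, q z = f t,
     u t = ucoord j z & u' t = ucoord j' z]) ->
  exists N, is_lift crossing f (fun t => mark (u t) (u' t)) N.
Proof.
move=> cu cu' hz; apply: local_lift => t t01.
have near16 (w : R -> R) : continuous w ->
    \forall p \near t, `|w t - w p| < 1 / 16.
  by move=> cw; have /cvgrPdist_lt/(_ (1 / 16)) := cw t; apply; lra.
have /nbhs_ballP[e e0 he] : nbhs t ([set p | `|u t - u p| < 1 / 16] `&`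
    [set p | `|u' t - u' p| < 1 / 16]).
  by apply: filterI; exact: near16.
exists e => // p r p01 r01 pe re.
have [/= hp hp'] : `|u t - u p| < 1 / 16 /\ `|u' t - u' p| < 1 / 16.
  by apply: he; rewrite /ball /= distrC.
have [/= hr hr'] : `|u t - u r| < 1 / 16 /\ `|u' t - u' r| < 1 / 16.
  by apply: he; rewrite /ball /= distrC.
have thE v : 0 <= v <= 1 -> [/\ theta j (f v) = circle_coord (u v),
    theta j' (f v) = circle_coord (u' v), 0 <= u v <= 1, 0 <= u' v <= 1 &
    u v = 0 \/ u' v = 0].
  move=> v01; have [z [dz <- -> ->]] := hz v v01.
  have z1 : 0 <= z.1 <= 1 by case: dz.
  rewrite !thetaE // !ucoord_in //; split=> //.
  have /eqP := ucoord_disjoint z jj'; rewrite mulf_eq0.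
  by case/orP => /eqP; [left|right].
have [p1 p2 p3 p4 p5] := thE p p01; have [r1 r2 r3 r4 r5] := thE r r01.
have d1 : `|u p - u r| < 1 / 8.
  by move: hp hr; rewrite /= !ltr_norml; lra.
have d2 : `|u' p - u' r| < 1 / 8.
  by move: hp' hr'; rewrite /= !ltr_norml; lra.
rewrite /crossing /C p1 p2 r1 r2; exact: mark_circle_coord.
Qed.

End SurfaceCocycle.

(** * The relations in the surface group *)

Lemma continuous_pair (X Y Z : topologicalType) (a : X -> Y) (b : X -> Z) :
  continuous a -> continuous b -> continuous (fun x => (a x, b x)).
Proof. by move=> ca cb x; exact: (cvg_pair (ca x) (cb x)). Qed.

Section PathHomotopy.
Variables (R : realType) (S : topologicalType).

Lemma continuous_loop (x0 : S) (f : R -> S) :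
  continuous f -> f 0 = x0 -> f 1 = x0 -> is_loop x0 f.
Proof. by move=> cf f0 f1; split => //; exact: continuous_subspaceT. Qed.

Lemma half_concat (a b : R -> S) (t : R) :
  loop_concat a b t = if t <= 1 / 2 then a (2 * t) else b (2 * t - 1).
Proof. by []. Qed.

Lemma comp_continuous (X : topologicalType) (f : R -> S) (s : X -> R) :
  continuous f -> continuous s -> continuous (fun x => f (s x)).
Proof.
by move=> cf cs x; apply: (@continuous_comp X R S s f); [exact: cs|exact: cf].
Qed.

(** At time [s] only the part of [b] between [s] and 1 is still run back and forth; at [s = 1] it
    has shrunk to the point [w]. *)
Lemma loop_homotopic_cancel (x0 w : S) (a b d : R -> S) :
  continuous a -> continuous b -> continuous d ->
  a 0 = x0 -> d 0 = x0 -> a 1 = w -> b 1 = w -> d 1 = w ->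
  loop_homotopic x0
    (loop_concat (loop_concat a (fun t => b (1 - t)))
                 (loop_concat b (fun t => d (1 - t))))
    (loop_concat a (fun t => d (1 - t))).
Proof.
move=> ca cb cd a0 d0 a1 b1 d1.
have two_minus : continuous (fun t : R => 2 - t).
  by move=> t; apply: cvgB; [exact: cvg_cst | exact: cvg_id].
pose there_back (f h : R -> S) t := if t <= 1 then f t else h (2 - t).
have ctb (f h : R -> S) : continuous f -> continuous h -> f 1 = h 1 ->
    continuous (there_back f h).
  move=> cf ch fh; apply: (@continuous_pasting _ _ _ id (fun=> 1)) => //.
  - by move=> t; exact: cvg_id.
  - exact: cst_continuous.
  - exact: comp_continuous.
  - by move=> t ->; have -> : 2 - 1 = 1 :> R by ring.
have cP : continuous (there_back a b) by apply: ctb => //; rewrite a1 b1.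
have cQ : continuous (there_back b d) by apply: ctb => //; rewrite b1 d1.
(* The factor [2 * (2 - s)] is the speed: 4 runs each path fully there and back in half a unit of
   time, 2 runs only [a] and then only [d] reversed. *)
pose H (z : R * R) := if z.2 <= 1 / 2
  then there_back a b (z.2 * (2 * (2 - clamp 1 z.1)))
  else there_back b d (2 - (1 - z.2) * (2 * (2 - clamp 1 z.1))).
have cfst : continuous (fun z : R * R => clamp 1 z.1).
  by move=> z; apply: (@continuous_comp (R * R)%type R R fst); [exact: cvg_fst|
    exact: clamp_continuous].
have csnd : continuous (fun z : R * R => z.2) by move=> z; exact: cvg_snd.
have cH : continuous H.
  apply: (@continuous_pasting _ _ _ (fun z => z.2) (fun=> 1 / 2)) => //.
  - exact: cst_continuous.
  - apply: comp_continuous => // z; apply: cvgM; first exact: csnd.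
    apply: cvgM; first exact: cvg_cst.
    by apply: cvgB; [exact: cvg_cst | exact: cfst].
  - apply: comp_continuous => // z; apply: cvgB; first exact: cvg_cst.
    apply: cvgM; first by apply: cvgB; [exact: cvg_cst | exact: csnd].
    apply: cvgM; first exact: cvg_cst.
    by apply: cvgB; [exact: cvg_cst | exact: cfst].
  - move=> z ->; have c01 := clamp_in z.1 (@ler01 R).
    have -> : 1 / 2 * (2 * (2 - clamp 1 z.1)) = 2 - clamp 1 z.1 by field.
    have -> : 2 - (1 - 1 / 2) * (2 * (2 - clamp 1 z.1)) = clamp 1 z.1 by field.
    rewrite /there_back; have -> : (clamp 1 z.1 <= 1) = true by case/andP: c01.
    case: ifP => h; last by congr b; ring.
    have -> : clamp 1 z.1 = 1 by lra.
    by have -> : 2 - 1 = 1 :> R by [ring]; rewrite a1 b1.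
exists H; split.
- exact: continuous_subspaceT.
- move=> t t01; rewrite /H /= clamp_id ?lexx ?ler01 // subr0.
  rewrite /loop_concat /there_back; case: ifP => t2.
    have -> : (2 * t <= 1 / 2) = (t * (2 * 2) <= 1) by apply/idP/idP; lra.
    by case: ifP => _; [congr a | congr b]; ring.
  have -> : (2 * t - 1 <= 1 / 2) = (2 - (1 - t) * (2 * 2) <= 1).
    by apply/idP/idP; lra.
  by case: ifP => _; [congr b | congr d]; ring.
- move=> t t01; rewrite /H /= clamp_id ?lexx ?ler01 //.
  rewrite /loop_concat /there_back; case: ifP => t2.
    by rewrite ifT; [congr a; ring | lra].
  by rewrite ifF; [congr d; ring | apply/negbTE; rewrite -ltNge; lra].
- move=> s s01; rewrite /H /= /there_back; split.
    by rewrite mul0r !ifT //; lra.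
  rewrite ifF; last by apply/negbTE; rewrite -ltNge; lra.
  rewrite subrr mul0r subr0 ifF; last by apply/negbTE; rewrite -ltNge; lra.
  by rewrite subrr.
Qed.

End PathHomotopy.

(** * Loops through the vertices of the polygon *)

Section SurfaceLoops.
Variables (R : realType) (S : topologicalType) (g : nat) (q : R * R -> S).
Hypothesis hS : hausdorff_space S.
Hypothesis qcont : {within @polar_disc R g, continuous q}.
Hypothesis qsurj : q @` @polar_disc R g = [set: S].
Hypothesis qglue : forall z z', @polar_disc R g z -> @polar_disc R g z' ->
  q z = q z' <-> polygon_glue g z z'.
Variables (z0 : R * R).
Hypothesis dz0 : @polar_disc R g z0.

Local Notation L := ((4 * g)%:R : R).
Local Notation x0 := (q z0).

Definition polar (r t : R) : S := q (clamp 1 r, clamp L t).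

Let L0 : 0 <= L. Proof. exact: ler0n. Qed.

Lemma polar_clamp_disc r t : @polar_disc R g (clamp 1 r, clamp L t).
Proof. by split; exact: clamp_in. Qed.

Lemma polarE r t : 0 <= r <= 1 -> 0 <= t <= L -> polar r t = q (r, t).
Proof. by move=> hr ht; rewrite /polar !clamp_id. Qed.

Lemma polar_continuous (X : topologicalType) (a b : X -> R) :
  continuous a -> continuous b -> continuous (fun x => polar (a x) (b x)).
Proof.
move=> ca cb x.
apply: (@continuous_comp X (R * R)%type S (fun x => (a x, b x))
  (q \o (fun z => (clamp 1 z.1, clamp L z.2)))).
  exact: continuous_pair.
apply: within_retract qcont _; first by move=> z; exact: polar_clamp_disc.
apply: continuous_pair => z.
  by apply: (@continuous_comp (R * R)%type R R fst);
    [exact: cvg_fst | exact: clamp_continuous].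
by apply: (@continuous_comp (R * R)%type R R snd);
  [exact: cvg_snd | exact: clamp_continuous].
Qed.

Lemma polar_centre t t' : polar 0 t = polar 0 t'.
Proof.
apply/qglue; try exact: polar_clamp_disc.
have -> : clamp 1 0 = 0 :> R by rewrite clamp_id ?lexx ?ler01.
by apply: glue_centre; exact: clamp_in.
Qed.

(** The base point may be any point of the surface: a ray goes straight from [z0] to the centre,
    then out to the boundary at angle [th]. *)
Definition ray (th s : R) : S :=
  if s <= 1 / 2 then polar (z0.1 * (1 - 2 * s)) z0.2 else polar (2 * s - 1) th.

Lemma ray_continuous (X : topologicalType) (a s : X -> R) :
  continuous a -> continuous s -> continuous (fun x => ray (a x) (s x)).
Proof.
move=> ca cs; have c2 : continuous (fun x => 2 * s x).
  by move=> x; apply: cvgM; [exact: cvg_cst | exact: cs].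
apply: (@continuous_pasting _ _ _ s (fun=> 1 / 2)) => //.
- exact: cst_continuous.
- apply: polar_continuous; last exact: cst_continuous.
  move=> x; apply: cvgM; first exact: cvg_cst.
  by apply: cvgB; [exact: cvg_cst | exact: c2].
- apply: polar_continuous => // x.
  by apply: cvgB; [exact: c2 | exact: cvg_cst].
- move=> x ->; have -> : 2 * (1 / 2) = 1 :> R by field.
  by rewrite subrr mulr0; exact: polar_centre.
Qed.

Lemma ray0 th : ray th 0 = x0.
Proof.
rewrite /ray ifT; last by lra.
rewrite mulr0 subr0 mulr1 polarE; first by case: z0.
  by case: dz0.
by case: dz0.
Qed.

Lemma ray1 th : ray th 1 = polar 1 th.
Proof.
rewrite /ray ifF; last by apply/negbTE; rewrite -ltNge; lra.
by congr polar; ring.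
Qed.

Lemma ray_path_continuous th : continuous (ray th).
Proof. by apply: ray_continuous => t; [exact: cvg_cst | exact: cvg_id]. Qed.

Definition chord (th th' : R) : R -> S :=
  loop_concat (ray th) (fun t => ray th' (1 - t)).

Lemma chord_continuous (X : topologicalType) (a a' s : X -> R) :
  continuous a -> continuous a' -> continuous s ->
  (forall x, polar 1 (a x) = polar 1 (a' x)) ->
  continuous (fun x => chord (a x) (a' x) (s x)).
Proof.
move=> ca ca' cs h; have c2 : continuous (fun x => 2 * s x).
  by move=> x; apply: cvgM; [exact: cvg_cst | exact: cs].
apply: (@continuous_pasting _ _ _ s (fun=> 1 / 2)) => //.
- exact: cst_continuous.
- exact: ray_continuous.
- apply: ray_continuous => // x; apply: cvgB; first exact: cvg_cst.
  by apply: cvgB; [exact: c2 | exact: cvg_cst].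
- move=> x ->; have -> : 2 * (1 / 2) = 1 :> R by field.
  by rewrite subrr subr0 !ray1.
Qed.

Lemma chord_loop th th' : polar 1 th = polar 1 th' -> is_loop x0 (chord th th').
Proof.
move=> h; apply: continuous_loop.
- apply: (@chord_continuous R (fun=> th) (fun=> th') id) => //.
  + exact: cst_continuous.
  + exact: cst_continuous.
  + by move=> t; exact: cvg_id.
- by rewrite /chord half_concat mulr0 ray0 ifT //; lra.
- rewrite /chord half_concat ifF; last by apply/negbTE; rewrite -ltNge; lra.
  by rewrite -(ray0 th'); congr ray; ring.
Qed.

(** When the two feet of a chord move along glued sides they stay at a common point of the surface,
    so the chord remains a loop throughout. The relations of the surface group come from this. *)
Lemma chord_slide (a a' : R -> R) : continuous a -> continuous a' ->
  (forall s, 0 <= s <= 1 -> polar 1 (a s) = polar 1 (a' s)) ->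
  loop_homotopic x0 (chord (a 0) (a' 0)) (chord (a 1) (a' 1)).
Proof.
move=> ca ca' h.
have cfst : continuous (fun z : R * R => clamp 1 z.1).
  by move=> z; apply: (@continuous_comp (R * R)%type R R fst); [exact: cvg_fst|
    exact: clamp_continuous].
have hc s : polar 1 (a (clamp 1 s)) = polar 1 (a' (clamp 1 s)).
  by apply: h; exact: clamp_in.
exists (fun z => chord (a (clamp 1 z.1)) (a' (clamp 1 z.1)) z.2); split.
- apply: continuous_subspaceT; apply: chord_continuous => //.
  + by move=> z; apply: (@continuous_comp (R * R)%type R R _ a);
      [exact: cfst | exact: ca].
  + by move=> z; apply: (@continuous_comp (R * R)%type R R _ a');
      [exact: cfst | exact: ca'].
  + by move=> z; exact: cvg_snd.
- by move=> t _; rewrite /= clamp_id ?lexx ?ler01.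
- by move=> t _; rewrite /= clamp_id ?lexx ?ler01.
- by move=> s s01; have [_ -> ->] := chord_loop (hc s).
Qed.

Lemma polar_side_a k s : (k < g)%N -> 0 <= s <= 1 ->
  polar 1 ((4 * k)%:R + s) = polar 1 ((4 * k + 3)%:R - s).
Proof.
move=> kg s01.
have kR : (4 * k)%:R + 4 <= L by rewrite -natrD ler_nat; lia.
have k0 : 0 <= (4 * k)%:R :> R by exact: ler0n.
have k3 : (4 * k + 3)%:R = (4 * k)%:R + 3 :> R by rewrite natrD.
rewrite k3 polarE; [|lra|lra]; rewrite polarE; [|lra|lra].
have d t : 0 <= t <= L -> @polar_disc R g (1, t).
  by move=> ht; split => //=; lra.
have d1 := d ((4 * k)%:R + s); have d2 := d ((4 * k)%:R + 3 - s).
apply/qglue; [apply: d1; lra | apply: d2; lra |].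
by rewrite -k3; exact: glue_a.
Qed.

Lemma polar_side_b k s : (k < g)%N -> 0 <= s <= 1 ->
  polar 1 ((4 * k + 1)%:R + s) = polar 1 ((4 * k + 4)%:R - s).
Proof.
move=> kg s01.
have kR : (4 * k)%:R + 4 <= L by rewrite -natrD ler_nat; lia.
have k0 : 0 <= (4 * k)%:R :> R by exact: ler0n.
have k1 : (4 * k + 1)%:R = (4 * k)%:R + 1 :> R by rewrite natrD.
have k4 : (4 * k + 4)%:R = (4 * k)%:R + 4 :> R by rewrite natrD.
rewrite k1 k4 polarE; [|lra|lra]; rewrite polarE; [|lra|lra].
have d t : 0 <= t <= L -> @polar_disc R g (1, t).
  by move=> ht; split => //=; lra.
have d1 := d ((4 * k)%:R + 1 + s); have d2 := d ((4 * k)%:R + 4 - s).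
apply/qglue; [apply: d1; lra | apply: d2; lra |].
by rewrite -k1 -k4; exact: glue_b.
Qed.

(** The gluings join the corners of a handle in the chain [4k], [4k + 3], [4k + 2], [4k + 1],
    [4k + 4]. Hence a chord between any two vertices is a loop. *)
Lemma polar_vertex i : (i <= 4 * g)%N -> polar 1 i%:R = polar 1 0.
Proof.
have side k : (k < g)%N -> [/\ polar 1 (4 * k)%:R = polar 1 (4 * k + 3)%:R,
    polar 1 (4 * k + 1)%:R = polar 1 (4 * k + 2)%:R,
    polar 1 (4 * k + 1)%:R = polar 1 (4 * k + 4)%:R &
    polar 1 (4 * k + 2)%:R = polar 1 (4 * k + 3)%:R].
  move=> kg; split.
  - by have := @polar_side_a k 0 kg; rewrite lexx ler01 addr0 subr0; exact.
  - have := @polar_side_a k 1 kg; rewrite lexx ler01 natr1 -addn1 => -> //.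
    by congr polar; rewrite !natrD; ring.
  - by have := @polar_side_b k 0 kg; rewrite lexx ler01 addr0 subr0; exact.
  - have := @polar_side_b k 1 kg.
    rewrite lexx ler01 natr1 -addn1 -addnA => -> //.
    by congr polar; rewrite !natrD; ring.
have corner k : (k <= g)%N -> polar 1 (4 * k)%:R = polar 1 0.
  elim: k => [|k IH] kg; first by rewrite muln0.
  have [s1 s2 s3 s4] := side _ kg.
  by rewrite mulnS addnC -s3 s2 s4 -s1 IH // ltnW.
move=> ig; have := corner (i %/ 4)%N.
have [kg|kg] := ltnP (i %/ 4) g; last first.
  have -> : i = (4 * (i %/ 4))%N by lia.
  by rewrite mulKn //; apply; lia.
move=> /(_ (ltnW kg)) h; have [s1 s2 s3 s4] := side _ kg.
have [->|[->|[->|->]]] : i = (4 * (i %/ 4))%N \/ i = (4 * (i %/ 4) + 1)%N \/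
    i = (4 * (i %/ 4) + 2)%N \/ i = (4 * (i %/ 4) + 3)%N by lia.
- by [].
- by rewrite s2 s4 -s1.
- by rewrite s4 -s1.
- by rewrite -s1.
Qed.

Lemma chord_period : chord L 0 = chord 0 0.
Proof.
apply/funext => t; rewrite /chord !half_concat; case: ifP => // _.
rewrite /ray; case: ifP => // _; apply/qglue; try exact: polar_clamp_disc.
have -> : clamp L L = L by rewrite clamp_id ?lexx ?ler0n.
have -> : clamp L 0 = 0 by rewrite clamp_id ?lexx ?ler0n.
by apply/glue_sym/glue_angle; exact: clamp_in.
Qed.

Variables (Gamma : groupType) (cls : (R -> S) -> Gamma).
Hypothesis cls_surj : forall x, exists2 f, is_loop x0 f & cls f = x.
Hypothesis cls_eq : forall f h, is_loop x0 f -> is_loop x0 h ->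
  cls f = cls h <-> loop_homotopic x0 f h.
Hypothesis cls_mul : forall f h, is_loop x0 f -> is_loop x0 h ->
  cls (loop_concat f h) = (cls f * cls h)%g.

Definition chord_class (i j : nat) : Gamma := cls (chord i%:R j%:R).

Let loopij i j : (i <= 4 * g)%N -> (j <= 4 * g)%N ->
  is_loop x0 (chord i%:R j%:R).
Proof. by move=> hi hj; apply: chord_loop; rewrite !polar_vertex. Qed.

Lemma chord_classM i j l : (i <= 4 * g)%N -> (j <= 4 * g)%N -> (l <= 4 * g)%N ->
  (chord_class i j * chord_class j l)%g = chord_class i l.
Proof.
move=> hi hj hl; rewrite /chord_class -cls_mul; try exact: loopij.
apply/cls_eq; try exact: loopij.
  exact: loop_concat_is_loop (loopij hi hj) (loopij hj hl).
by apply: (@loop_homotopic_cancel _ _ _ (polar 1 0));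
  rewrite ?ray0 ?ray1 ?polar_vertex //; exact: ray_path_continuous.
Qed.

Lemma chord_class_side_a k : (k < g)%N ->
  chord_class (4 * k) (4 * k + 3) = chord_class (4 * k + 1) (4 * k + 2).
Proof.
move=> kg; apply/cls_eq; try by apply: loopij; lia.
have := @chord_slide (fun s => (4 * k)%:R + s) (fun s => (4 * k + 3)%:R - s).
have -> : (4 * k)%:R + 1 = (4 * k + 1)%:R :> R by rewrite natrD.
have -> : (4 * k + 3)%:R - 1 = (4 * k + 2)%:R :> R by rewrite !natrD; ring.
rewrite addr0 subr0; apply.
- by move=> s; apply: cvgD; [exact: cvg_cst | exact: cvg_id].
- by move=> s; apply: cvgB; [exact: cvg_cst | exact: cvg_id].
- by move=> s; exact: polar_side_a.
Qed.

Lemma chord_class_side_b k : (k < g)%N ->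
  chord_class (4 * k + 1) (4 * k + 4) = chord_class (4 * k + 2) (4 * k + 3).
Proof.
move=> kg; apply/cls_eq; try by apply: loopij; lia.
have := @chord_slide (fun s => (4 * k + 1)%:R + s)
  (fun s => (4 * k + 4)%:R - s).
have -> : (4 * k + 1)%:R + 1 = (4 * k + 2)%:R :> R by rewrite !natrD; ring.
have -> : (4 * k + 4)%:R - 1 = (4 * k + 3)%:R :> R by rewrite !natrD; ring.
rewrite addr0 subr0; apply.
- by move=> s; apply: cvgD; [exact: cvg_cst | exact: cvg_id].
- by move=> s; apply: cvgB; [exact: cvg_cst | exact: cvg_id].
- by move=> s; exact: polar_side_b.
Qed.

Lemma chord_class00 : chord_class 0 0 = 1%g.
Proof.
apply: (mulgI (chord_class 0 0)).
by rewrite chord_classM // mulg1.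
Qed.

Lemma chord_class_div i j : (i <= 4 * g)%N -> (j <= 4 * g)%N ->
  (chord_class i 0 * (chord_class j 0)^-1)%g = chord_class i j.
Proof.
by move=> hi hj; rewrite -(chord_classM hi hj (leq0n _)) mulgK.
Qed.



Hypothesis hg : (2 <= g)%N.

(** The coordinates are explicit along a ray, which gives lifts of it and of its reverse with known
    end values. *)
Lemma ray_lift (G : groupType) (x y : G) (b : bool) th : 0 <= th <= L ->
  exists C N,
  [/\ is_lift (crossing qsurj x y 0 1 b) (ray th) C N,
      C 0 = mark x y (ucoord (4 * 0 + b) z0) (ucoord (4 * 1 + b) z0) &
      C 1 = mark x y (trapezoid (4 * 0 + b) th) (trapezoid (4 * 1 + b) th)] /\
  exists D M,
  [/\ is_lift (crossing qsurj x y 0 1 b) (fun t => ray th (1 - t)) D M,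
      D 1 = mark x y (ucoord (4 * 0 + b) z0) (ucoord (4 * 1 + b) z0) &
      D 0 = mark x y (trapezoid (4 * 0 + b) th) (trapezoid (4 * 1 + b) th)].
Proof.
move=> hth.
(* Both halves of the ray in one continuous formula: the maxima switch off the second term on the
   first half and the first term on the second half. *)
pose u j (t : R) := z0.1 * (Num.max 0 (1 - 2 * t) * trapezoid j z0.2)
  + Num.max 0 (2 * t - 1) * trapezoid j th.
have c2 (e : R) : continuous (fun t : R => 2 * t - e).
  move=> t; apply: cvgB; last exact: cvg_cst.
  by apply: cvgM; [exact: cvg_cst | exact: cvg_id].
have c2' (e : R) : continuous (fun t : R => e - 2 * t).
  move=> t; apply: cvgB; first exact: cvg_cst.
  by apply: cvgM; [exact: cvg_cst | exact: cvg_id].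
have cu j : continuous (u j).
  move=> t; apply: cvgD; apply: cvgM; try exact: cvg_cst.
    apply: cvgM; last exact: cvg_cst.
    by apply: (@continuous_max R R (fun=> 0) (fun t : R => 1 - 2 * t));
      [exact: cvg_cst | exact: c2'].
  by apply: (@continuous_max R R (fun=> 0) (fun t : R => 2 * t - 1));
    [exact: cvg_cst | exact: c2].
have cu' j : continuous (fun t : R => u j (1 - t)).
  move=> t; apply: (@continuous_comp R R R (fun t : R => 1 - t) (u j));
    last exact: cu.
  by apply: cvgB; [exact: cvg_cst | exact: cvg_id].
have u0 j : u j 0 = ucoord j z0.
  have m1 : Num.max 0 (1 - 2 * 0) = 1 :> R by rewrite max_r; lra.
  have m2 : Num.max 0 (2 * 0 - 1) = 0 :> R by rewrite max_l; lra.
  by rewrite /u m1 m2 mul0r addr0 mul1r.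
have u1 j : u j 1 = trapezoid j th.
  have m1 : Num.max 0 (1 - 2 * 1) = 0 :> R by rewrite max_l; lra.
  have m2 : Num.max 0 (2 * 1 - 1) = 1 :> R by rewrite max_r; lra.
  by rewrite /u m1 m2 mul0r mulr0 add0r mul1r.
have hz (t : R) : 0 <= t <= 1 -> exists z,
    [/\ @polar_disc R g z, q z = ray th t &
    forall j, u j t = ucoord j z].
  move=> t01; have [z1 z2] := dz0; rewrite /ray; case: ifP => t2.
    exists (z0.1 * (1 - 2 * t), z0.2).
    have d : 0 <= z0.1 * (1 - 2 * t) <= 1 by apply/andP; split; nra.
    rewrite polarE //; split=> // j.
    have m1 : Num.max 0 (1 - 2 * t) = 1 - 2 * t by rewrite max_r; lra.
    have m2 : Num.max 0 (2 * t - 1) = 0 by rewrite max_l; lra.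
    by rewrite /u /ucoord m1 m2 /=; ring.
  exists (2 * t - 1, th); rewrite polarE //; [|lra].
  split=> //; first by split=> //=; lra.
  move=> j; have m1 : Num.max 0 (1 - 2 * t) = 0 by rewrite max_l; lra.
  have m2 : Num.max 0 (2 * t - 1) = 2 * t - 1 by rewrite max_r; lra.
  by rewrite /u /ucoord m1 m2 /=; ring.
(* The two curves run on handles 0 and 1; [hg] provides the second. *)
have lift01 := @crossing_lift R S g q qsurj qglue _ x y 0 1 b isT hg.
have [N hN] := @lift01 (ray th) _ _ (cu (4 * 0 + b)%N) (cu (4 * 1 + b)%N)
  (fun t t01 => let: ex_intro z (And3 d e h) := hz t t01 in
    ex_intro _ z (And4 d e (h _) (h _))).
exists (fun t => mark x y (u (4 * 0 + b)%N t) (u (4 * 1 + b)%N t)), N.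
rewrite !u0 !u1; split; first by split.
have hz' (t : R) : 0 <= t <= 1 -> exists z, [/\ @polar_disc R g z,
    q z = ray th (1 - t), u (4 * 0 + b)%N (1 - t) = ucoord (4 * 0 + b) z &
    u (4 * 1 + b)%N (1 - t) = ucoord (4 * 1 + b) z].
  move=> t01; have [|z [d e h]] := hz (1 - t); first lra.
  by exists z.
have [M hM] := @lift01 (fun t => ray th (1 - t)) _ _ (cu' (4 * 0 + b)%N)
  (cu' (4 * 1 + b)%N) hz'.
exists (fun t => mark x y (u (4 * 0 + b)%N (1 - t))
  (u (4 * 1 + b)%N (1 - t))), M.
by rewrite subrr subr0 !u0 !u1.
Qed.

Lemma chord_hom (G : groupType) (x y : G) (b : bool) :
  exists psi : Gamma -> G, (forall a a', psi (a * a')%g = (psi a * psi a')%g) /\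
    forall i j, (i <= 4 * g)%N -> (j <= 4 * g)%N ->
      psi (chord_class i j) =
      (mark x y (trapezoid (4 * 0 + b) (i%:R : R))
                (trapezoid (4 * 1 + b) (i%:R : R)) *
       (mark x y (trapezoid (4 * 0 + b) (j%:R : R))
                 (trapezoid (4 * 1 + b) (j%:R : R)))^-1)%g.
Proof.
have hc := @crossing_locally_multiplicative R S g q hS qcont qsurj qglue
  _ x y 0 1 b isT hg.
have [psi [psiM psiE]] := transport_hom hc cls_surj cls_eq cls_mul.
(* The base point may itself carry a mark; conjugating by it leaves only the marks of the
   vertices. *)
set m0 := mark x y (ucoord (4 * 0 + b) z0) (ucoord (4 * 1 + b) z0).
exists (fun a => m0 * psi a * m0^-1)%g; split.
  by move=> a a'; rewrite psiM !mulgA mulgVK.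
move=> i j hi hj; rewrite /chord_class.
have iL k : (k <= 4 * g)%N -> 0 <= (k%:R : R) <= L.
  by move=> h; rewrite ler0n ler_nat.
have [C [N [[hC C0 C1] _]]] := @ray_lift _ x y b _ (iL i hi).
have [_ [_ [_ [D [M [hD D1 D0]]]]]] := @ray_lift _ x y b _ (iL j hj).
have meet : ray i%:R 1 = ray j%:R (1 - 0).
  by rewrite subr0 !ray1 !polar_vertex.
have [E [K [hE EE]]] := lift_concat meet hC hD.
rewrite (psiE _ E K (loopij hi hj) hE) EE C0 C1 D0 D1 -/m0.
by rewrite !mulgA mulgV mul1g mulgK.
Qed.

End SurfaceLoops.

Lemma trapezoid_nat (R : realType) j i :
  trapezoid j (i%:R : R) = ((i == j + 1) || (i == j + 2))%N%:R.
Proof.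
have [h|h] := leqP i j.
  rewrite trapezoid_l ?ler_nat //.
  by have -> : ((i == j + 1) || (i == j + 2))%N = false by lia.
have [h'|h'] := leqP (j + 3) i.
  rewrite trapezoid_r; last by rewrite -natrD ler_nat.
  by have -> : ((i == j + 1) || (i == j + 2))%N = false by lia.
rewrite trapezoid_mid; last by rewrite natr1 -natrD !ler_nat; lia.
by have -> : ((i == j + 1) || (i == j + 2))%N by lia.
Qed.

(** The whole input from topology. The first coordinate is 1 at vertices [b + 1] and [b + 2], the
    second at [b + 5] and [b + 6]; at the other vertices, in particular at vertex 0, both vanish. *)
Lemma surface_group_data (R : realType) (S : topologicalType) (g : nat)
    (x0 : S) (Gamma : groupType) :
  hausdorff_space S -> has_genus R S g -> (2 <= g)%N ->
  fundamental_group R x0 Gamma ->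
  exists c : nat -> Gamma,
  [/\ c 0%N = 1%g, c (4 * g)%N = 1%g,
      (forall i, (i < g)%N ->
        (c (4 * i)%N * (c (4 * i + 3)%N)^-1
         = c (4 * i + 1)%N * (c (4 * i + 2)%N)^-1)%g),
      (forall i, (i < g)%N ->
        (c (4 * i + 1)%N * (c (4 * i + 4)%N)^-1
         = c (4 * i + 2)%N * (c (4 * i + 3)%N)^-1)%g) &
      forall (b : bool) (G : groupType) (x y : G), exists psi : Gamma -> G,
        (forall a a', psi (a * a')%g = (psi a * psi a')%g) /\
        forall i, (i <= 4 * g)%N -> psi (c i) =
          if ((i == b + 1) || (i == b + 2))%N then x
          else if ((i == b + 5) || (i == b + 6))%N then y else 1%g].
Proof.
move=> hS [q [qcont qsurj qglue]] hg [cls [cls_surj cls_eq cls_mul]].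
have [z0 [dz0 zx0]] := exists_polar qsurj x0.
rewrite -zx0 in cls_surj cls_eq cls_mul.
have g0 : (0 <= 4 * g)%N by [].
exists (fun i => @chord_class R S g q z0 Gamma cls i 0); split.
- exact: chord_class00 cls_eq cls_mul.
- rewrite /chord_class chord_period //; exact: chord_class00 cls_eq cls_mul.
- move=> i ig.
  rewrite !(chord_class_div qcont qglue dz0 cls_eq cls_mul); try lia.
  exact: chord_class_side_a cls_eq _ _.
- move=> i ig.
  rewrite !(chord_class_div qcont qglue dz0 cls_eq cls_mul); try lia.
  exact: chord_class_side_b cls_eq _ _.
- move=> b G x y.
  have [psi [psiM psiE]] := chord_hom hS qcont qsurj qglue dz0
    cls_surj cls_eq cls_mul hg x y b.
  exists psi; split => // i ig; rewrite psiE // !trapezoid_nat /mark.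
  have -> : ((0 == 4 * 0 + b + 1) || (0 == 4 * 0 + b + 2))%N = false by lia.
  have -> : ((0 == 4 * 1 + b + 1) || (0 == 4 * 1 + b + 2))%N = false by lia.
  have -> : ((i == 4 * 0 + b + 1) || (i == 4 * 0 + b + 2))%N =
    ((i == b + 1) || (i == b + 2))%N by lia.
  have -> : ((i == 4 * 1 + b + 1) || (i == 4 * 1 + b + 2))%N =
    ((i == b + 5) || (i == b + 6))%N by lia.
  have h0 : (1 / 2 <= 0 :> R) = false by apply/negbTE; rewrite -ltNge; lra.
  have h1 : (1 / 2 <= 1 :> R) = true by lra.
  rewrite h0 invg1 mulg1.
  by do 2!case: (_ || _)%N; rewrite ?h0 ?h1.
Qed.

(** * Edge stabilizers *)

Section Morphisms.
Variables (G H : groupType) (f : G -> H).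
Hypothesis fM : forall a b, f (a * b)%g = (f a * f b)%g.

Lemma morph1 : f 1%g = 1%g.
Proof. by apply: (mulgI (f 1%g)); rewrite -fM !mulg1. Qed.

Lemma morphV a : f (a^-1)%g = ((f a)^-1)%g.
Proof. by apply: (mulgI (f a)); rewrite -fM !mulgV morph1. Qed.

Lemma morphX a n : f (a ^+ n)%g = (f a ^+ n)%g.
Proof. by elim: n => [|n IH]; rewrite ?expg0 ?morph1 // !expgS fM IH. Qed.

Lemma word_val_morph x w : f (word_val x w) = word_val (fun i => f (x i)) w.
Proof.
elim: w => [|l w IH]; first exact: morph1.
rewrite !word_val_cons fM IH; congr (_ * _)%g.
by rewrite /letter_val; case: l.2; rewrite ?morphV.
Qed.

Lemma freely_independent_morph x :
  freely_independent (fun i => f (x i)) -> freely_independent x.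
Proof.
move=> h w rw w0 e; apply: (h w rw w0).
by rewrite -word_val_morph e morph1.
Qed.

End Morphisms.

Lemma eq_freely_independent (G : groupType) (x y : 'I_2 -> G) :
  x =1 y -> freely_independent x -> freely_independent y.
Proof. by move=> /funext ->. Qed.

(** * The action on lattice classes *)

Section BTAction.
Variables (F : fieldType) (v : F -> int) (pi : F).
Hypothesis (hv : discrete_valuation v) (hpi : uniformizer v pi).
Variables (Gamma : groupType) (rho : Gamma -> 'M[F]_2).
Hypothesis hrho : SL2_representation rho.

Lemma repX x n : rho (x ^+ n)%g = rho x ^+ n.
Proof.
elim: n => [|n IH]; first by rewrite expg0 expr0 (rep1 hrho).
by rewrite expgS hrho.2 IH exprS mulmxE.
Qed.

Definition lattice (B : 'M[F]_2) : set 'cV[F]_2 :=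
  [set B *m x | x in [set x : 'cV[F]_2 | forall i, valuation_ring v (x i 0)]].

(** The elements mapping the lattice of [N] into itself. They form a group because the inverse of a
    matrix of determinant 1 is its adjugate. *)
Definition integral_fixer (N : 'M[F]_2) : set Gamma :=
  [set x | mxvge v (invmx N *m rho x *m N) 0].

Lemma fixer_group N : N \in unitmx ->
  [/\ integral_fixer N 1%g,
      (forall x y, integral_fixer N x -> integral_fixer N y ->
         integral_fixer N (x * y)%g) &
      (forall x, integral_fixer N x -> integral_fixer N x^-1%g)].
Proof.
move=> uN; have conjM x y : invmx N *m rho (x * y)%g *m N =
    (invmx N *m rho x *m N) *m (invmx N *m rho y *m N).
  by rewrite hrho.2 -!mulmxA (mulKVmx uN).
have conj1 : invmx N *m rho 1%g *m N = 1%:M.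
  by rewrite (rep1 hrho) mulmx1 mulVmx.
split.
- by rewrite /integral_fixer /= conj1; exact: mxvge1.
- move=> x y hx hy; rewrite /integral_fixer /= conjM.
  by have := mxvgeM hv hx hy; rewrite addr0.
- move=> x hx; rewrite /integral_fixer /=; set K := invmx N *m rho x *m N in hx.
  have detK : \det K = 1.
    by rewrite !det_mulmx hrho.1 mulr1 -det_mulmx mulVmx // det1.
  have uK : K \in unitmx by rewrite unitmxE detK unitr1.
  have -> : invmx N *m rho x^-1%g *m N = adj22 K.
    apply: (can_inj (mulKmx uK)).
    by rewrite -conjM mulgV conj1 mul22_adj detK.
  exact: (mxvge_adj hv hx).
Qed.

Lemma mulmx_col_integral K (w : 'cV[F]_2) : mxvge v K 0 ->
  (forall i, valuation_ring v (w i 0)) ->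
  forall i, valuation_ring v ((K *m w) i 0).
Proof.
move=> hK hw i; rewrite mxE !big_ord_recl big_ord0 addr0.
by have := vgeD hv (vgeM hv (hK i ord0) (hw ord0))
  (vgeM hv (hK i (lift ord0 ord0)) (hw (lift ord0 ord0))); rewrite addr0.
Qed.

Lemma fixer_vertex N x : N \in unitmx -> integral_fixer N x ->
  bt_action rho x (homothety_class (lattice N)) = homothety_class (lattice N).
Proof.
move=> uN hx.
have [h1 hM hV] := fixer_group uN.
have sub y a : integral_fixer N y ->
      [set rho y *m u | u in scale_set a (lattice N)] `<=`
      scale_set a (lattice N).
  move=> hy _ [_ [_ [w hw <-] <-] <-].
  exists (N *m (invmx N *m rho y *m N *m w)).
    by exists (invmx N *m rho y *m N *m w) => //; exact: mulmx_col_integral.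
  by rewrite -scalemxAr !mulmxA mulmxV // mul1mx.
have fixL a : [set rho x *m u | u in scale_set a (lattice N)] =
    scale_set a (lattice N).
  apply/seteqP; split; first exact: sub.
  move=> u hu; exists (rho x^-1%g *m u).
    by apply: (sub _ _ (hV _ hx)); exists u.
  by rewrite mulmxA -hrho.2 mulgV (rep1 hrho) mul1mx.
apply/seteqP; split.
  by move=> _ [_ [a a0 <-] <-]; rewrite fixL; exists a.
move=> _ [a a0 <-]; exists (scale_set a (lattice N)); first by exists a.
exact: fixL.
Qed.

Lemma action_vertex N x :
  bt_action rho x (homothety_class (lattice N)) =
  homothety_class (lattice (rho x *m N)).
Proof.
have imL a : [set rho x *m u | u in scale_set a (lattice N)] =
    scale_set a (lattice (rho x *m N)).
  apply/seteqP; split.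
    move=> _ [_ [_ [w hw <-] <-] <-].
    exists (rho x *m N *m w); first by exists w.
    by rewrite -scalemxAr mulmxA.
  move=> _ [_ [w hw <-] <-]; exists (a *: (N *m w)).
    by exists (N *m w) => //; exists w.
  by rewrite -scalemxAr mulmxA.
apply/seteqP; split.
  by move=> _ [_ [a a0 <-] <-]; rewrite imL; exists a.
move=> _ [a a0 <-]; exists (scale_set a (lattice N)); first by exists a.
exact: imL.
Qed.

Lemma vertex_lattice C : bt_vertex v C ->
  exists2 N, N \in unitmx & C = homothety_class (lattice N).
Proof. by move=> [_ [N uN ->] <-]; exists N. Qed.

Lemma fixer_edge N N' x : N \in unitmx -> N' \in unitmx ->
  integral_fixer N x -> integral_fixer N' x ->
  edge_stabilizer (bt_action rho)
    [set homothety_class (lattice N); homothety_class (lattice N')] x.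
Proof.
move=> uN uN' hN hN'; rewrite /edge_stabilizer /= /edge_action.
by rewrite image_setU !image_set1 !fixer_vertex.
Qed.

Lemma free_rank2_edge_stabilizer N N' (x : 'I_2 -> Gamma) :
  N \in unitmx -> N' \in unitmx -> freely_independent x ->
  (forall i, integral_fixer N (x i) /\ integral_fixer N' (x i)) ->
  contains_free_rank2 (edge_stabilizer (bt_action rho)
    [set homothety_class (lattice N); homothety_class (lattice N')]).
Proof.
move=> uN uN' fx hx; exists x; split => // _ [w _ <-].
have gen M : M \in unitmx -> (forall i, integral_fixer M (x i)) ->
    integral_fixer M (word_val x w).
  move=> uM hM; have [h1 hMul hV] := fixer_group uM.
  elim: w => [|l w IH]; first exact: h1.
  rewrite word_val_cons; apply: hMul => //; rewrite /letter_val.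
  by case: l.2; [apply: hV|]; exact: hM.
by apply: fixer_edge => //; apply: gen => // i; case: (hx i).
Qed.

Lemma exists_edge : exists e, bt_edge v pi e.
Proof.
have pi0 := uniformizer_neq0 hpi; have e0 := uniformizer_gt0 hpi.
(* The edge from the standard lattice to the one with basis scaled by 1 and [pi]; each of the two
   basis vectors shows that one inclusion is strict. *)
pose B : 'M[F]_2 := \matrix_(i, j)
  if i == j then (if i == 0 then 1 else pi) else 0.
have uB : B \in unitmx.
  by rewrite unitmxE det_mx22 !mxE /= mul1r mul0r subr0 unitfE.
have u1 : (1%:M : 'M[F]_2) \in unitmx by exact: unitmx1.
have BE (w : 'cV[F]_2) i : (B *m w) i 0 = (if i == 0 then 1 else pi) * w i 0.
  rewrite mxE !big_ord_recl big_ord0 addr0 !mxE.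
  by elim/ord2_ind: i; rewrite /= ?mul0r ?addr0 ?add0r //;
    congr (_ * w _ _); exact: val_inj.
have v1 : valuation_ring v 1 by right; rewrite (valuation1 hv).
have v0 : valuation_ring v 0 by left.
have vpi : valuation_ring v pi by right; exact: ltW.
have vM a b : valuation_ring v a -> valuation_ring v b ->
    valuation_ring v (a * b).
  by move=> ha hb; have := vgeM hv ha hb; rewrite addr0.
have vpiV a : valuation_ring v a -> pi * a <> 1.
  move=> ha h; have a0 : a != 0.
    by apply/eqP => a0; move/eqP: h; rewrite a0 mulr0 eq_sym oner_eq0.
  have := valuationM hv pi0 a0; rewrite h (valuation1 hv).
  case: ha => [/eqP|]; first by rewrite (negPf a0).
  lia.
exists [set homothety_class (lattice 1%:M); homothety_class (lattice B)].
exists (homothety_class (lattice 1%:M)), (homothety_class (lattice B)); split.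
- by exists (lattice 1%:M) => //; exists 1%:M.
- by exists (lattice B) => //; exists B.
- have inC L : homothety_class L L.
    exists 1; first by rewrite /= oner_neq0.
    apply/seteqP; split => [_ [u hu <-]|u hu]; first by rewrite /= scale1r.
    by exists u; rewrite // scale1r.
  exists (lattice 1%:M), (lattice B).
  split; [exact: inC | exact: inC | split | split].
  + move=> _ [_ [w hw <-] <-]; rewrite mul1mx.
    exists (\col_i (if i == 0 then pi * w i 0 else w i 0)).
      by move=> i; rewrite mxE; case: ifP => _ //; exact: vM.
    apply/colP => i; rewrite BE !mxE; case: ifP => _ //.
    by rewrite mul1r.
  + move=> /(_ (\col_i (i == 0)%:R)) [].
      exists (\col_i (i == 0)%:R).
        by move=> i; rewrite mxE; case: (i == 0).
      apply/colP => i; rewrite BE !mxE.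
      by case: (i == 0); rewrite ?mul1r ?mulr0.
    move=> _ [w hw <-] /colP /(_ 0); rewrite mul1mx !mxE /=.
    exact: vpiV.
  + move=> _ [w hw <-]; exists (B *m w); last by rewrite mul1mx.
    by move=> i; rewrite BE; apply: vM => //; case: ifP.
  + move=> /(_ (\col_i (i == 1)%:R)) [].
      exists (\col_i (i == 1)%:R); last by rewrite mul1mx.
      by move=> i; rewrite mxE; case: (i == 1).
    by move=> w hw /colP /(_ 1); rewrite BE !mxE /=; exact: vpiV.
- by [].
Qed.

End BTAction.

(** * Free subgroups of edge stabilizers *)

Section FreeEdgeStabilizers.
Variables (F : fieldType) (v : F -> int) (pi : F).
Hypothesis (hv : discrete_valuation v) (hpi : uniformizer v pi).
Hypothesis hfin : finite_set (residue_field v).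
Variables (Gamma : groupType) (rho : Gamma -> 'M[F]_2).
Hypothesis hrho : SL2_representation rho.

Lemma stabilizer_power (h : Gamma) (M N N' : frame F) :
  frame_eqv v (frame_act hrho h M) M ->
  exists2 n, (0 < n)%N & integral_fixer v rho (val N) (h ^+ n)%g /\
                         integral_fixer v rho (val N') (h ^+ n)%g.
Proof.
case: (bruhat_tits_rooted_tree hv hpi) => [[_ es _] _ _ _] /es.
rewrite /frame_eqv /= mulmxA => fixM.
have [n n0 hn] := vertex_stabilizer_power hv hpi hfin N (hrho.1 h) fixM.
have [n' n'0 hn'] := vertex_stabilizer_power hv hpi hfin N' (hrho.1 h) fixM.
have [uN uN'] := (valP N, valP N'); rewrite /= in uN uN'.
exists (n * n')%N; first by rewrite muln_gt0 n0.
rewrite /integral_fixer /= !(repX hrho); split.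
  by rewrite exprM -mx_pow_conj //; exact: mxvgeX.
by rewrite mulnC exprM -mx_pow_conj //; exact: mxvgeX.
Qed.

(** The conjugators of the free group lift to [y i]. The conjugate of [h] by [y i] fixes the
    translate of [M] by [y i], so a power of it lies in both fixers; freeness is read off from the
    images, whatever the powers are. *)
Lemma free_in_edge_stabilizer (psi : Gamma -> free_group2) (X : 'I_2 -> Gamma)
    (h : Gamma) (M N N' : frame F) :
  (forall a b, psi (a * b)%g = (psi a * psi b)%g) ->
  (forall i, psi (X i) = fg_gen (i, false)) ->
  frame_eqv v (frame_act hrho h M) M -> psi h != 1%g ->
  exists x : 'I_2 -> Gamma, freely_independent x /\
    forall i, integral_fixer v rho (val N) (x i) /\
              integral_fixer v rho (val N') (x i).
Proof.
move=> psiM psiX fixM h1.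
have [g gP] := conj_powers_freely_independent h1.
pose y i := word_val X (g i).
have yE i : psi (y i) = g i.
  rewrite /y (word_val_morph psiM) -[RHS]word_val_fg.
  by congr word_val; apply/funext => j; rewrite psiX.
have [_ actM acte _] := frame_actP v pi hrho.
have fixy i : frame_eqv v (frame_act hrho (y i * h * (y i)^-1)%g
    (frame_act hrho (y i) M)) (frame_act hrho (y i) M).
  by rewrite -actM mulgVK actM; exact: acte.
have ex i : exists n, (0 < n)%N /\
    (integral_fixer v rho (val N) ((y i * h * (y i)^-1) ^+ n)%g /\
     integral_fixer v rho (val N') ((y i * h * (y i)^-1) ^+ n)%g).
  by have [n n0 hn] := stabilizer_power N N' (fixy i); exists n.
have [n nP] := choice ex.
exists (fun i => ((y i * h * (y i)^-1) ^+ n i)%g); split; last first.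
  by move=> i; case: (nP i).
apply: (freely_independent_morph psiM).
apply: eq_freely_independent (gP n (fun i => (nP i).1)) => i.
by rewrite (morphX psiM) !psiM (morphV psiM) yE conj_expg.
Qed.

Lemma edge_stabilizer_contains_free (g : nat) (c : nat -> Gamma)
    (N N' : 'M[F]_2) : N \in unitmx -> N' \in unitmx -> (2 <= g)%N ->
  c 0%N = 1%g -> c (4 * g)%N = 1%g ->
  (forall i, (i < g)%N ->
    (c (4 * i)%N * (c (4 * i + 3)%N)^-1
     = c (4 * i + 1)%N * (c (4 * i + 2)%N)^-1)%g) ->
  (forall i, (i < g)%N ->
    (c (4 * i + 1)%N * (c (4 * i + 4)%N)^-1
     = c (4 * i + 2)%N * (c (4 * i + 3)%N)^-1)%g) ->
  (forall (b : bool) (G : groupType) (x y : G), exists psi : Gamma -> G,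
    (forall a a', psi (a * a')%g = (psi a * psi a')%g) /\
    forall i, (i <= 4 * g)%N -> psi (c i) =
      if ((i == b + 1) || (i == b + 2))%N then x
      else if ((i == b + 5) || (i == b + 6))%N then y else 1%g) ->
  contains_free_rank2 (edge_stabilizer (bt_action rho)
    [set homothety_class (lattice v N); homothety_class (lattice v N')]).
Proof.
move=> uN uN' hg c0 cg ra rb hom.
have [psi psiP] : {psi : bool -> Gamma -> free_group2 & forall b,
    (forall a a', psi b (a * a')%g = (psi b a * psi b a')%g) /\
    forall i, (i <= 4 * g)%N -> psi b (c i) =
      if ((i == b + 1) || (i == b + 2))%N then fg_gen (0, false)
      else if ((i == b + 5) || (i == b + 6))%N then fg_gen (1, false) else 1%g}.
  apply: (@choice bool (Gamma -> free_group2) (fun b psi =>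
    (forall a a', psi (a * a')%g = (psi a * psi a')%g) /\
    forall i, (i <= 4 * g)%N -> psi (c i) =
      if ((i == b + 1) || (i == b + 2))%N then fg_gen (0, false)
      else if ((i == b + 5) || (i == b + 6))%N
      then fg_gen (1, false) else 1%g)).
  by move=> b; exact: hom.
have [[b [M [h [fixM h1]]]]|none] := pselect (exists b M h,
    frame_eqv v (frame_act hrho h M) M /\ psi b h != 1%g).
  have [psiM psiE] := psiP b.
  (* One vertex for each of the two marks; both exist since [4 * g] is at least 8. *)
  pose X (i : 'I_2) := c (b + (if i == 0%R then 1 else 5))%N.
  have psiX i : psi b (X i) = fg_gen (i, false).
    rewrite psiE; last by case: (b); case: ifP => _; lia.
    elim/ord2_ind: i => /=; first by rewrite eqxx.
    have -> : ((b + 5 == b + 1) || (b + 5 == b + 2))%N = false by lia.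
    by rewrite eqxx.
  pose fN : frame F := exist _ N uN; pose fN' : frame F := exist _ N' uN'.
  have [x [fx hx]] := free_in_edge_stabilizer fN fN' psiM psiX fixM h1.
  exact: free_rank2_edge_stabilizer hx.
(* The first component sees only the curve on handle 0: on the [c i] these characters are the
   indicators of vertices 1, 2 and of vertices 2, 3, as [surface_cup_product_neq0] requires. *)
pose a h := exponent_sum (psi false h); pose b h := exponent_sum (psi true h).
have exp0 : exponent_sum (fg_gen (0, false)) = 1.
  by rewrite /exponent_sum /= big_seq1.
have exp1 : exponent_sum (fg_gen (1, false)) = 0.
  by rewrite /exponent_sum /= big_seq1.
have exp_one : exponent_sum 1%g = 0 by rewrite /exponent_sum fword1 big_nil.
have vanish d M h : frame_eqv v (frame_act hrho h M) M ->
    exponent_sum (psi d h) = 0.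
  move=> fixM; have [-> //|h1] := eqVneq (psi d h) 1%g.
  by case: none; exists d, M, h.
have aM x y : a (x * y)%g = a x + a y by rewrite /a (psiP _).1 exponent_sumM.
have bM x y : b (x * y)%g = b x + b y by rewrite /b (psiP _).1 exponent_sumM.
pose u0 : frame F := exist _ 1%:M (unitmx1 F 2).
have [k kM] := cup_product_coboundary (bruhat_tits_rooted_tree hv hpi)
  (frame_actP v pi hrho) u0 aM bM (fun x u => @vanish false u x)
  (fun x u => @vanish true u x).
exfalso; apply: (surface_cup_product_neq0 _ c0 cg ra rb aM bM _ _ kM).
- by lia.
- move=> i ig; rewrite /a (psiP _).2 //= !add0n.
  by case: ifP => // _; case: ifP.
- move=> i ig; rewrite /b (psiP _).2 //= !add1n.
  by case: ifP => // _; case: ifP.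
Qed.

End FreeEdgeStabilizers.

Theorem theorem1p3 (R : realType)
  (F : fieldType) (v : F -> int) (pi : F) (c : R)
  (hc : 0 < c < 1)
  (hv : discrete_valuation v)
  (hpi : uniformizer v pi)
  (hF : locally_compact_valued_field v c)
  (hchar : [pchar F] =i pred0)
  (Sigma : topologicalType) (g : nat) (x0 : Sigma) (Gamma : groupType)
  (hSigma : compact_riemann_surface R Sigma)
  (hgenus : has_genus R Sigma g)
  (hg : (2 <= g)%N)
  (hGamma : fundamental_group R x0 Gamma)
  (rho : Gamma -> 'M[F]_2)
  (hrho : SL2_representation rho)
  (hred : reductive_rep rho) :
  (~ bounded_rep v c rho ->
     ~ small_action (bt_action rho) (bt_edge v pi) /\
     exists2 e, bt_edge v pi e &
       forall gamma : Gamma,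
         contains_free_rank2
           (edge_stabilizer (bt_action rho)
              (edge_action (bt_action rho) gamma e))) /\
  (dense_rep v c rho ->
     forall e, bt_edge v pi e ->
       contains_free_rank2 (edge_stabilizer (bt_action rho) e)).
Proof.
have [hausS _ _ _] := hSigma.
have [cc [c0 cg ra rb hom]] := surface_group_data hausS hgenus hg hGamma.
(* Stated for two frames, so that it applies alike to an edge and to its translates, whose frames
   are multiplied by [rho gamma]. *)
have key N N' : N \in unitmx -> N' \in unitmx ->
    contains_free_rank2 (edge_stabilizer (bt_action rho)
      [set homothety_class (lattice v N); homothety_class (lattice v N')]).
  move=> uN uN'.
  exact: (edge_stabilizer_contains_free hv hpi hF.2 hrho uN uN' hg
    c0 cg ra rb hom).
have free e : bt_edge v pi e ->
    contains_free_rank2 (edge_stabilizer (bt_action rho) e).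
  move=> [C [C' [/vertex_lattice[N uN ->] /vertex_lattice[N' uN' ->] _ ->]]].
  exact: key.
split => [_|_]; last exact: free.
have [e he] := exists_edge hv hpi; split.
  by move=> /(_ e he); apply; exact: free.
exists e => // gamma.
move: he => [C [C' [/vertex_lattice[N uN ->] /vertex_lattice[N' uN' ->] _ ->]]].
rewrite /edge_action image_setU !image_set1 !action_vertex.
by apply: key; rewrite unitmx_mul (rep_unit hrho).
Qed.
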